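(* Let $T$ be the binary tree and suppose $\alpha(t)=\alpha_{|t|}$ and $\sigma(t)=\sigma_{|t|}$, $t\in T$, for two sequences $(\alpha_k)_{k\ge0}$ and $(\sigma_k)_{k\ge0}$ of positive numbers with $(\sigma_k)$ non-increasing. Let $X_t=\sigma(t)\sum_{v\preceq t}\alpha(v)\xi_v$, $t\in T$. (1) If $$\sup_{n\ge1}\ \sup_{n\le k\le 2n}\frac{\alpha_k}{\alpha_n}<\infty,\qquad(\ast)$$ then $X$ is a.s. bounded if and only if $$\sup_{n\ge1}\ \sigma_n\sum_{k=1}^n\alpha_k<\infty.\qquad(\ast\ast)$$ In particular, if the $\alpha_k$ are non-increasing, then $(\ast)$ is always satisfied, hence in that case $X$ is a.s. bounded if and only if $(\ast\ast)$ is valid. (2) If the $\alpha_k$ are non-decreasing, then $X$ is a.s. bounded if and only if $$\sup_{n\ge1}\ \sigma_n\sqrt n\Big(\sum_{k=0}^n\alpha_k^2\Big)^{1/2}<\infty.$$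
   Context: The binary tree is the infinite rooted tree with root $\mathbf 0$ in which every element has exactly two offspring. $t\preceq s$ means that $t$ lies on the branch connecting $\mathbf 0$ with $s$ (including $t=s$); $t\prec s$ means $t\preceq s$, $t\neq s$; $|s|:=\#\{t\in T:t\prec s\}$ is the order (level) of $s$. $(\xi_v)_{v\in T}$ are i.i.d. standard normal random variables. $X$ is a.s. bounded means $\mathbb P(\sup_{t\in T}|X_t|<\infty)=1$. *)

(* Defs.v *)
From HB Require Import structures.
From mathcomp Require Import all_boot all_order all_algebra finmap.
From mathcomp Require Import all_classical all_reals all_analysis.

Set Implicit Arguments.
Unset Strict Implicit.
Unset Printing Implicit Defensive.

Import Order.TTheory GRing.Theory Num.Theory.
Import numFieldNormedType.Exports.

Local Open Scope classical_set_scope.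
Local Open Scope fset_scope.
Local Open Scope ring_scope.

(** Vertices are finite binary words: the root is [[::]], the two offspring
    of [t] are [rcons t false] and [rcons t true]. *)
Definition btree : Type := seq bool.
HB.instance Definition _ := Countable.copy btree (seq bool).

Definition tle (t s : btree) : bool := prefix t s.
Definition tlt (t s : btree) : bool := tle t s && (t != s).

Definition level (s : btree) : nat := #|` fset_set [set t | tlt t s]|.

Lemma tleP (t s : btree) :
  reflect (exists2 k, (k < (size s).+1)%N & t = take k s) (tle t s).
Proof.
apply: (iffP idP) => [|[k _ ->]]; last exact: prefix_take.
rewrite /tle prefixE => /eqP ts; exists (size t) => //.
by rewrite ltnS -{1}ts size_take_min geq_minr.
Qed.

Lemma mem_take_iota (s t : btree) n :
  reflect (exists2 k, (k < n)%N & t = take k s)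
          (t \in [seq (take k s : btree) | k <- iota 0 n]).
Proof.
by apply: (iffP mapP) => -[k kn ->]; exists k => //; move: kn; rewrite mem_iota add0n.
Qed.

Lemma tle_setE (s : btree) :
  [set t | tle t s] = [set` [seq (take k s : btree) | k <- iota 0 (size s).+1]].
Proof.
apply/seteqP; split=> t H; first by apply/mem_take_iota; apply/tleP.
by apply/tleP; apply/mem_take_iota.
Qed.

Lemma uniq_take_iota (s : btree) n : (n <= (size s).+1)%N ->
  uniq [seq (take k s : btree) | k <- iota 0 n].
Proof.
move=> ns; rewrite map_inj_in_uniq ?iota_uniq// => i j.
rewrite !mem_iota !add0n /= => iI jI /(congr1 size).
by rewrite !size_takel// -ltnS (leq_trans _ ns).
Qed.

Lemma tlt_setE (s : btree) :
  [set t | tlt t s] = [set` [seq (take k s : btree) | k <- iota 0 (size s)]].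
Proof.
apply/seteqP; split=> t.
  case/andP => /tleP[k]; rewrite ltnS leq_eqVlt => /orP[/eqP ->|ks] ->.
    by rewrite take_size eqxx.
  by move=> _; apply/mem_take_iota; exists k.
case/mem_take_iota => k ks ->; apply/andP; split; first exact: prefix_take.
apply: contraTneq ks => /(congr1 size); rewrite size_take_min => <-.
by rewrite -leqNgt geq_minl.
Qed.

Lemma levelE (s : btree) : level s = size s.
Proof.
rewrite /level tlt_setE; set l := map _ _.
have -> : [set` l] = [set` [fset t in l]] by apply/seteqP; split=> t /=; rewrite inE.
by rewrite set_fsetK card_fseq undup_id ?uniq_take_iota// size_map size_iota.
Qed.

Lemma sum_ancestorsE (V : nmodType) (t : btree) (F : btree -> V) :
  \sum_(v \in [set v | tle v t]) F v = \sum_(0 <= k < (size t).+1) F (take k t).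
Proof.
by rewrite tle_setE -fsbig_seq ?uniq_take_iota// big_map /index_iota subn0.
Qed.

Section process.
Context {d : measure_display} {Omega : measurableType d} {R : realType}.
Variable P : probability Omega R.

(* Equality is required on Borel sets only: [normal_prob] is an integral, which
   is not meaningful on other sets. *)
Definition standard_normal (X : {RV P >-> R}) : Prop :=
  forall A : set R, measurable A -> distribution P X A = normal_prob 0 1 A.

Definition mutually_independent (I : choiceType) (X : I -> {RV P >-> R}) : Prop :=
  forall (J : {fset I}) (A : I -> set R),
    (forall i, i \in J -> measurable (A i)) ->
    (P (\bigcap_(i in [set` J]) (X i @^-1` A i)) =
     \prod_(i <- J) P (X i @^-1` A i))%E.

Definition tree_process (sigma alpha : btree -> R) (xi : btree -> {RV P >-> R})
    (t : btree) (w : Omega) : R :=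
  sigma t * \sum_(v \in [set v | tle v t]) alpha v * xi v w.

Definition as_bounded (X : btree -> Omega -> R) : Prop :=
  P [set w | (ereal_sup [set `|X t w|%:E | t in [set: btree]] < +oo)%E] = 1%E.

End process.

(* Main.v *)
(* Write S_t for the sum of alpha(v) xi_v over v in the branch of t, so that
   X_t = sigma(t) S_t.

   Upper bounds. For weights c(n, k), put Z_t = sum_k c(|t|, k) xi_{t_k} over the
   branch (t_k) of t, v_n = sum_k c(n, k)^2 and lambda_n = sqrt (n / v_n). The
   expectation of sum_t exp(- 3|t|) exp(lambda |Z_t|) is at most a convergent
   geometric series, hence almost surely |Z_t| <= K sqrt (n v_n) for all t at once,
   n = |t|. With c(n, k) = alpha_k this is the sufficiency in (2). For (1), take
   c(n, k) = alpha_k if k > n/2 and 0 otherwise: Z_t is then the increment of S between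
   the levels n/2 and n, and by the doubling condition it is bounded by a constant
   times the sum of alpha_k over n/4 < k <= n/2; these bounds telescope.

   Lower bounds. If |X| <= B, then S_s - S_t <= 2B / sigma_{|s|} whenever t is a
   prefix of s. For (1), follow from the root the child with the larger xi: the
   Laplace transform of S along this greedy branch is multiplicative, and since
   E exp(- s max(xi, xi')) <= exp(- kappa s) for small s >= 0, Markov's inequality
   gives P(|X| <= B) <= exp(- kappa^2 / 2) unless sigma_n sum_(k <= n) alpha_k <= 4B / kappa.
   For (2), continue each of the 2^h vertices of level h = n/2 by one branch down
   to level n. These increments are independent, and each exceeds sqrt (h V) / 8,
   where V is its variance, with probability at least 2^-h by the Paley-Zygmund
   inequality for exp(lambda U), so one of them does with probability at least
   1 - 1/e. *)
Require Import Defs.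
From HB Require Import structures.
From mathcomp Require Import all_boot all_order all_algebra finmap.
From mathcomp Require Import all_classical all_reals all_analysis.
From mathcomp Require Import measurable_realfun.
From mathcomp Require Import ring lra zify.

Set Implicit Arguments.
Unset Strict Implicit.
Unset Printing Implicit Defensive.

Import Order.TTheory GRing.Theory Num.Theory.
Import numFieldNormedType.Exports.

Local Open Scope classical_set_scope.
Local Open Scope ring_scope.

(** * Independence *)

Section independence.
Context {d : measure_display} {Omega : measurableType d} {R : realType}.
Variables (P : probability Omega R) (I : choiceType) (X : I -> {RV P >-> R}).

(** The pi-system of finite-dimensional events in the coordinates of [K]; it generates the
    sigma-algebra of the variables [X i] with [i] in [K]. *)
Definition cylinder (K : set I) : set (set Omega) :=
  [set B | exists J : {fset I}, exists A : I -> set R,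
    [/\ [set` J] `<=` K, forall i, measurable (A i) &
        B = \bigcap_(i in [set` J]) (X i @^-1` A i)]].

Lemma measurable_cylinder (K : set I) : cylinder K `<=` measurable.
Proof.
move=> _ [J [A [_ mA ->]]]; apply: fin_bigcap_measurable => // i _.
by rewrite -[X in measurable X]setTI; exact: measurable_funPT.
Qed.

Lemma setI_closed_cylinder (K : set I) : setI_closed (cylinder K).
Proof.
move=> _ _ [J1 [A1 [J1K mA1 ->]]] [J2 [A2 [J2K mA2 ->]]].
exists (J1 `|` J2)%fset.
(* Padding with [setT] outside [J] writes both cylinders over the same index set. *)
pose A (J : {fset I}) (B : I -> set R) i := if i \in J then B i else setT.
have mA J B : (forall i, measurable (B i)) -> forall i, measurable (A J B i).
  by move=> mB i; rewrite /A; case: ifP.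
exists (fun i => A J1 A1 i `&` A J2 A2 i); split.
- by move=> i /=; rewrite inE => /orP[/J1K|/J2K].
- by move=> i; apply: measurableI; exact: mA.
- apply/seteqP; split=> w.
    by move=> [w1 w2] i _ /=; rewrite /A; split; case: ifPn => // iJ;
      [apply: w1|apply: w2].
  move=> wA; split=> i /= iJ; have := wA i; rewrite /= inE iJ ?orbT => /(_ isT).
    by rewrite /A iJ => -[].
  by rewrite /A iJ => -[].
Qed.

Lemma cylinderT (K : set I) : cylinder K setT.
Proof.
exists fset0, (fun=> setT); split => //.
by apply/seteqP; split=> // w _ i /=; rewrite inE.
Qed.

Lemma measurable_sigma_cylinder (K : set I) :
  <<s cylinder K >> `<=` measurable.
Proof.
exact: smallest_sub (@sigma_algebra_measurable _ Omega) (@measurable_cylinder K).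
Qed.

Hypothesis Xindep : mutually_independent X.

Lemma cylinder_indep (K1 K2 : set I) (B1 B2 : set Omega) :
  K1 `&` K2 = set0 -> cylinder K1 B1 -> cylinder K2 B2 ->
  (P (B1 `&` B2) = P B1 * P B2)%E.
Proof.
move=> K12 [J1 [A1 [J1K mA1 ->]]] [J2 [A2 [J2K mA2 ->]]].
have J12 i : i \in J1 -> i \in J2 -> False.
  by move=> /J1K iK1 /J2K iK2; have : (K1 `&` K2) i by []; rewrite K12.
pose A i := if i \in J1 then A1 i else A2 i.
have AJ2 i : i \in J2 -> A i = A2 i.
  by rewrite /A; case: ifPn => // i1 /(J12 _ i1).
have -> : \bigcap_(i in [set` J1]) X i @^-1` A1 i `&`
          \bigcap_(i in [set` J2]) X i @^-1` A2 i =
          \bigcap_(i in [set` (J1 `|` J2)%fset]) X i @^-1` A i.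
  apply/seteqP; split=> w.
    move=> [w1 w2] i /=; rewrite inE => /orP[] iJ.
      by rewrite /A iJ; exact: w1.
    by rewrite AJ2//; exact: w2.
  move=> wA; split=> i /= iJ; have := wA i; rewrite /= inE iJ ?orbT => /(_ isT).
    by rewrite /A iJ.
  by rewrite AJ2.
have mA i : measurable (A i) by rewrite /A; case: ifP.
have perm12 : perm_eq (J1 `|` J2)%fset (J1 ++ J2).
  apply: uniq_perm; rewrite ?fset_uniq ?cat_uniq ?fset_uniq ?andbT//=.
    by apply/hasPn => i i2; apply/negP => /J12; exact.
  by move=> i; rewrite inE mem_cat.
rewrite !Xindep// (perm_big _ perm12) big_cat/=.
congr (_ * _)%E; rewrite !big_seq; apply: eq_bigr => i iJ.
  by rewrite /A iJ.
by rewrite AJ2.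
Qed.

(** For fixed [C], the probability of [D] intersected with [C] and the product [P D * P C] are
    finite measures in [D], so their agreement on the pi-system extends to the sigma-algebra. This
    is applied to each of the two events in turn. *)
Lemma sigma_cylinder_indep (K1 K2 : set I) (A B : set Omega) :
  K1 `&` K2 = set0 -> <<s cylinder K1 >> A -> <<s cylinder K2 >> B ->
  (P (A `&` B) = P A * P B)%E.
Proof.
move=> K12 sA sB.
have mext (K : set I) (C : set Omega) : measurable C ->
    (forall D, cylinder K D -> P (D `&` C) = P D * P C)%E ->
    forall D, <<s cylinder K >> D -> (P (D `&` C) = P D * P C)%E.
  move=> mC h D sD.
  pose r := NngNum (fine_ge0 (measure_ge0 P C)).
  have rE : (r%:num%:E = P C)%E by rewrite /= fineK ?fin_num_measure.
  have : mrestr P mC D = mscale r P D.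
    apply: (g_sigma_algebra_measure_unique (cylinder K) _ (fun=> setT)) sD => //.
    - exact: measurable_cylinder.
    - by move=> _; exact: cylinderT.
    - by rewrite bigcup_const.
    - exact: setI_closed_cylinder.
    - move=> E KE; rewrite -[LHS]/(P (E `&` C)) h//.
      by rewrite -[RHS]/(r%:num%:E * P E)%E rE muleC.
    - by move=> _; apply: le_lt_trans (probability_le1 P _) _;
        rewrite ?ltry// setTI.
  by rewrite -[LHS]/(P (D `&` C)) -[RHS]/(r%:num%:E * P D)%E rE muleC.
have mB : measurable B by exact: measurable_sigma_cylinder sB.
apply: (mext K1) => // D KD; rewrite setIC muleC.
apply: (mext K2) => //; first exact: measurable_cylinder KD.
by move=> E KE; rewrite (cylinder_indep _ KE KD)// setIC.
Qed.

Definition adapted (K : set I) (f : Omega -> R) : Prop :=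
  measurable_fun [set: g_sigma_algebraType (cylinder K)]
    (f : g_sigma_algebraType (cylinder K) -> R).

Lemma adapted_preimage (K : set I) (f : Omega -> R) (A : set R) :
  adapted K f -> measurable A -> <<s cylinder K >> (f @^-1` A).
Proof. by move=> Kf mA; have := Kf measurableT A mA; rewrite setTI. Qed.

Lemma adapted_measurable (K : set I) (f : Omega -> R) :
  adapted K f -> measurable_fun setT f.
Proof.
move=> Kf _ A mA; rewrite setTI; apply: measurable_sigma_cylinder.
exact: adapted_preimage Kf mA.
Qed.

Lemma adaptedS (K K' : set I) (f : Omega -> R) :
  K `<=` K' -> adapted K f -> adapted K' f.
Proof.
move=> KK' Kf _ A mA; rewrite setTI.
apply: sub_sigma_algebra2 (adapted_preimage Kf mA).
by move=> _ [J [B [JK mB ->]]]; exists J, B; split => // i /JK /KK'.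
Qed.

Lemma adapted_coord (i : I) : adapted [set i] (X i).
Proof.
move=> _ A mA; rewrite setTI; apply: sub_sigma_algebra.
exists [fset i]%fset, (fun=> A); split => //.
  by move=> j /=; rewrite inE => /eqP ->.
apply/seteqP; split=> w.
  by move=> wA j /=; rewrite inE => /eqP ->.
by move=> /(_ i); rewrite /= inE eqxx => /(_ isT).
Qed.

(** By independence the joint law of [f] and [g] is the product of their laws, and Tonelli separates
    the integral. *)
Lemma expectation_mul_adapted (K1 K2 : set I) (f g : Omega -> R) :
  K1 `&` K2 = set0 -> adapted K1 f -> adapted K2 g ->
  (forall w, 0 <= f w) -> (forall w, 0 <= g w) ->
  (\int[P]_w (f w * g w)%:E = (\int[P]_w (f w)%:E) * (\int[P]_w (g w)%:E))%E.
Proof.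
move=> K12 Kf Kg f0 g0.
have mf := adapted_measurable Kf; have mg := adapted_measurable Kg.
pose F : {mfun Omega >-> R} := mfun_Sub (mem_set mf).
pose G : {mfun Omega >-> R} := mfun_Sub (mem_set mg).
have mFG : measurable_fun setT (fun w => (f w, g w)).
  exact: measurable_fun_pair.
pose H : {mfun Omega >-> (R * R)%type} := mfun_Sub (mem_set mFG).
(* The truncations make [h] nonnegative on the whole plane, as Tonelli requires, and change nothing
   at the values of [f] and [g]. *)
pose h (z : R * R) : \bar R := (Num.max 0 z.1 * Num.max 0 z.2)%:E.
have mmax : measurable_fun setT (fun x : R => Num.max 0 x).
  exact: measurable_maxr.
have mh : measurable_fun setT h.
  apply/measurable_EFinP; apply: measurable_funM.
    exact: measurableT_comp measurable_fst.
  exact: measurableT_comp measurable_snd.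
have max0 (x : R) : 0 <= Num.max 0 x by rewrite le_max lexx.
have h0 z : (0 <= h z)%E by rewrite lee_fin mulr_ge0.
transitivity (\int[distribution P H]_z h z)%E.
  rewrite ge0_integral_distribution//; apply: eq_integral => w _ /=.
  by rewrite /h/= !max_r.
transitivity (\int[(distribution P F \x distribution P G)%E]_z h z)%E.
  apply: eq_measure_integral => A mA _; apply/esym/product_measure_unique => //.
  move=> B C mB mC; rewrite /distribution/= /pushforward/=.
  exact: (sigma_cylinder_indep K12 (adapted_preimage Kf mB)
    (adapted_preimage Kg mC)).
rewrite fubini_tonelli1//.
transitivity (\int[distribution P F]_x
    ((Num.max 0 x)%:E * \int[distribution P G]_y (Num.max 0 y)%:E))%E.
  apply: eq_integral => x _; rewrite /fubini_F/h/=.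
  under eq_integral do rewrite EFinM.
  rewrite ge0_integralZl//; [exact/measurable_EFinP| |by rewrite lee_fin].
  by move=> y _; rewrite lee_fin.
rewrite ge0_integralZr//; last 3 first.
- exact/measurable_EFinP.
- by move=> x _; rewrite lee_fin.
- by apply: integral_ge0 => y _; rewrite lee_fin.
congr (_ * _)%E; rewrite ge0_integral_distribution//=; try exact/measurable_EFinP;
  try (by move=> y; rewrite lee_fin); apply: eq_integral => w _ /=; congr EFin;
  exact: max_r.
Qed.

Lemma expectation_prod_adapted (T : eqType) (r : seq T) (K : T -> set I)
    (f : T -> Omega -> R) :
  uniq r ->
  (forall i j, i \in r -> j \in r -> i != j -> K i `&` K j = set0) ->
  (forall i, i \in r -> adapted (K i) (f i)) ->
  (forall i w, 0 <= f i w) ->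
  (\int[P]_w (\prod_(i <- r) f i w)%:E =
   \prod_(i <- r) \int[P]_w (f i w)%:E)%E.
Proof.
move=> + + + f0; elim: r => [|i r IH] /=.
  move=> _ _ _; under eq_integral do rewrite big_nil.
  rewrite big_nil integral_cst//= mul1e; exact: probability_setT.
move=> /andP[ir ur] Kdisj Kf.
under eq_integral do rewrite big_cons.
rewrite big_cons -IH//; last 2 first.
- by move=> j k jr kr; apply: Kdisj; rewrite inE ?jr ?kr orbT.
- by move=> j jr; apply: Kf; rewrite inE jr orbT.
(* The remaining product is adapted to the union of the other index sets, which is disjoint from
   [K i]. *)
apply: (@expectation_mul_adapted (K i) (\bigcup_(j in [set` r]) K j)) => //.
- rewrite setI_bigcupr bigcup0// => j /= jr; apply: Kdisj.
  + exact: mem_head.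
  + by rewrite inE jr orbT.
  + by apply: contraNneq ir => ->.
- by apply: Kf; exact: mem_head.
- apply: measurable_prod => j jr.
  apply: (@adaptedS (K j)); first by move=> k Kk; exists j.
  by apply: Kf; rewrite inE jr orbT.
- by move=> w; apply: prodr_ge0.
Qed.

End independence.

Arguments adapted_coord {d Omega R P I} X i.

(** * Exponential moments of normal variables *)

Section normal_moments.
Context {R : realType}.

(** The Radon-Nikodym derivative of the normal law equals [normal_pdf] almost everywhere, because
    both have the same integral over every measurable set. *)
Lemma ge0_integral_normal_prob (m s : R) (f : R -> \bar R) :
  measurable_fun setT f -> (forall x, 0 <= f x)%E ->
  (\int[normal_prob m s]_x f x =
   \int[lebesgue_measure]_x (f x * (normal_pdf m s x)%:E))%E.
Proof.
move=> mf f0.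
have dom := normal_prob_dominates m s.
have mpdf : measurable_fun setT (fun x : R => (normal_pdf m s x)%:E).
  by apply/measurable_EFinP; exact: measurable_normal_pdf.
rewrite -(Radon_Nikodym_SigmaFinite.change_of_variables dom f0 measurableT mf).
have intf := Radon_Nikodym_SigmaFinite.f_integrable dom.
apply: ae_eq_integral => //.
- by apply: emeasurable_funM => //; exact: measurable_int intf.
- exact: emeasurable_funM.
- apply: ae_eqe_mul2l; apply: integral_ae_eq => // E _ mE.
  by rewrite -(Radon_Nikodym_SigmaFinite.f_integral dom mE).
Qed.

Lemma mgf_normal_prob (s : R) :
  (\int[normal_prob 0 1]_x (expR (s * x))%:E = (expR (s ^+ 2 / 2))%:E)%E.
Proof.
have mexp : measurable_fun setT (fun x : R => (expR (s * x))%:E).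
  by apply/measurable_EFinP; apply: measurableT_comp.
rewrite ge0_integral_normal_prob//.
(* Completing the square: tilting the standard density by [expR (s * x)] gives, up to a constant,
   the density with mean [s]. *)
transitivity (\int[lebesgue_measure]_x
    ((expR (s ^+ 2 / 2))%:E * (normal_pdf s 1 x)%:E))%E.
  apply: eq_integral => x _; rewrite -!EFinM !normal_pdfE ?oner_eq0//.
  congr EFin; rewrite !(mulrCA (expR _)); congr (_ * _).
  rewrite /normal_fun -!expRD; congr expR.
  by rewrite expr1n subr0; field.
rewrite ge0_integralZl//.
- by rewrite integral_normal_pdf mule1.
- by apply/measurable_EFinP; exact: measurable_normal_pdf.
- by move=> x _; rewrite lee_fin normal_pdf_ge0.
Qed.

Lemma normal_prob_itv_gt0 (a b : R) : a < b ->
  (0 < normal_prob 0 1 `[a, b])%E.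
Proof.
move=> ab; pose c := normal_peak 1 * expR (- (a ^+ 2 + b ^+ 2) / 2) : R.
have c0 : 0 < c by rewrite mulr_gt0 ?expR_gt0// normal_peak_gt0 ?oner_eq0.
apply: (@lt_le_trans _ _ (\int[lebesgue_measure]_(x in `[a, b]) (cst c%:E x))%E).
  rewrite integral_cst//= lebesgue_measure_itv/= lte_fin ab -EFinB -EFinM lte_fin.
  by rewrite mulr_gt0// subr_gt0.
apply: ge0_le_integral => //.
- by move=> x _; rewrite lee_fin ltW.
- by apply/measurable_EFinP/measurable_funTS; exact: measurable_normal_pdf.
- move=> x /=; rewrite in_itv/= => /andP[ax xb].
  rewrite lee_fin normal_pdfE ?oner_eq0// ler_pM2l ?normal_peak_gt0 ?oner_eq0//.
  have : x ^+ 2 <= a ^+ 2 + b ^+ 2 by case: (leP 0 x) => x0; nra.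
  by rewrite ler_expR subr0 expr1n => ?; lra.
Qed.

End normal_moments.

Section gaussian_family.
Context {d : measure_display} {Omega : measurableType d} {R : realType}.
Variables (P : probability Omega R) (I : choiceType) (X : I -> {RV P >-> R}).
Hypothesis Xnormal : forall i, standard_normal (X i).
Hypothesis Xindep : mutually_independent X.

Lemma integral_standard_normal (i : I) (f : R -> \bar R) :
  measurable_fun setT f -> (forall x, 0 <= f x)%E ->
  (\int[P]_w f (X i w) = \int[normal_prob 0 1]_x f x)%E.
Proof.
move=> mf f0.
have mX : measurable_fun setT (X i : Omega -> measurableTypeR R).
  exact: (measurable_funPT (X i)).
pose X' : {mfun Omega >-> measurableTypeR R} := 
  @mfun_Sub _ _ Omega (measurableTypeR R) _ (mem_set mX).
rewrite -[LHS](@ge0_integral_distribution _ _ _ _ _ P X' f mf f0).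
by apply: eq_measure_integral => A mA _; exact: Xnormal.
Qed.

Lemma mgf_standard_normal (i : I) (s : R) :
  (\int[P]_w (expR (s * X i w))%:E = (expR (s ^+ 2 / 2))%:E)%E.
Proof.
rewrite -mgf_normal_prob.
apply: (@integral_standard_normal i (fun x => (expR (s * x))%:E)) => //.
by apply/measurable_EFinP; apply: measurableT_comp.
Qed.

Lemma adapted_linear (T : eqType) (r : seq T) (v : T -> I) (c : T -> R) :
  adapted X [set v k | k in [set` r]] (fun w => \sum_(k <- r) c k * X (v k) w).
Proof.
(* [measurable_sum] asks for measurability of every summand, so the summands at [k] outside [r] are
   replaced by 0. *)
rewrite [f in adapted _ _ f](_ : _ = fun w => \sum_(k <- r)
    (if k \in r then c k * X (v k) w else 0)); last first.
  by apply/funext => w; rewrite !big_seq; apply: eq_bigr => k ->.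
apply: measurable_sum => k.
have [kr|_] := boolP (k \in r); last exact: measurable_cst.
apply: measurable_funM; first exact: measurable_cst.
by apply: (adaptedS _ (adapted_coord X (v k))) => _ ->; exists k.
Qed.

Lemma mgf_linear (T : eqType) (r : seq T) (v : T -> I) (c : T -> R) :
  uniq r -> {in r &, injective v} ->
  (\int[P]_w (expR (\sum_(k <- r) c k * X (v k) w))%:E =
   (expR ((\sum_(k <- r) c k ^+ 2) / 2))%:E)%E.
Proof.
move=> ur vinj.
under eq_integral do rewrite expR_sum.
rewrite (expectation_prod_adapted Xindep (K := fun k => [set v k]))//.
- under eq_bigr do rewrite mgf_standard_normal.
  by rewrite prodEFin -expR_sum mulr_suml.
- move=> i j ir jr ij; apply/seteqP; split=> // k [-> /= vij].
  by move: ij; rewrite (vinj _ _ ir jr vij) eqxx.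
- move=> k _; apply: measurableT_comp => //.
  by apply: measurable_funM; [exact: measurable_cst|exact: adapted_coord].
Qed.

End gaussian_family.

Arguments adapted_linear {d Omega R P I} X {T} r v c.

(** * The minimum of two independent exponentials *)

Section min_of_two.
Context {d : measure_display} {Omega : measurableType d} {R : realType}.
Variables (P : probability Omega R) (I : choiceType) (X : I -> {RV P >-> R}).
Hypothesis Xnormal : forall i, standard_normal (X i).
Hypothesis Xindep : mutually_independent X.

(** With [u = s ^+ 2 / 2], at most 1/2, this combines [1 - u <= expR (- u)] and
    [1 <= (1 - u) * (1 + 2 * u)]. *)
Lemma expR_half_sqr_le (s : R) : 0 <= s <= 1 -> expR (s ^+ 2 / 2) <= 1 + s ^+ 2.
Proof.
move=> /andP[s0 s1]; have s21 : s ^+ 2 <= 1 by nra.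
have := expR_ge1Dx (- (s ^+ 2 / 2)); rewrite expRN => H.
have e0 := expR_gt0 (s ^+ 2 / 2).
have {}H : (1 - s ^+ 2 / 2) * expR (s ^+ 2 / 2) <= 1.
  by rewrite -ler_pdivlMr// div1r.
have s20 : 0 <= s ^+ 2 by exact: sqr_ge0.
nra.
Qed.

Lemma expRN_le (s : R) : 0 <= s <= 1 -> expR (- s) <= 1 - s / 2.
Proof.
move=> /andP[s0 s1]; rewrite expRN -div1r ler_pdivrMr ?expR_gt0//.
have := expR_ge1Dx s; have := expR_gt0 s; nra.
Qed.

(* The gain over the exponential moment of a single normal variable comes from
   the event where one variable is nonpositive and the other at least 1. *)
Lemma expectation_min_expR : exists2 kappa : R, 0 < kappa <= 1 &
  forall i j (s : R), i != j -> 0 <= s <= kappa ->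
  (\int[P]_w (Num.min (expR (- (s * X i w))) (expR (- (s * X j w))))%:E <=
   (expR (- (kappa * s)))%:E)%E.
Proof.
have mX i : measurable_fun setT (X i) by exact: measurable_funPT.
pose A : set R := `[-1, 0]%classic; pose B : set R := `[1, 2]%classic.
have mA : measurable A by exact: measurable_itv.
have mB : measurable B by exact: measurable_itv.
pose pA := fine (normal_prob 0 1 A : \bar R).
pose pB := fine (normal_prob 0 1 B : \bar R).
have pAE i : (P (X i @^-1` A) = pA%:E)%E.
  rewrite -[LHS]/(distribution P (X i) A) Xnormal// /pA fineK//.
  exact: (fin_num_measure (normal_prob 0 1)).
have pBE i : (P (X i @^-1` B) = pB%:E)%E.
  rewrite -[LHS]/(distribution P (X i) B) Xnormal// /pB fineK//.
  exact: (fin_num_measure (normal_prob 0 1)).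
have fine_itv (D : set R) : (0 < normal_prob 0 1 D)%E -> measurable D ->
    0 < fine (normal_prob 0 1 D : \bar R) <= 1.
  move=> D0 mD; have D1 := probability_le1 (normal_prob 0 1) mD.
  rewrite fine_gt0 ?D0 ?(le_lt_trans D1) ?ltry//=.
  by rewrite -lee_fin fineK// (fin_num_measure (normal_prob 0 1)).
have /andP[pA0 pA1] : 0 < pA <= 1.
  by apply: fine_itv => //; apply: normal_prob_itv_gt0; lra.
have /andP[pB0 pB1] : 0 < pB <= 1.
  by apply: fine_itv => //; apply: normal_prob_itv_gt0; lra.
pose p := pA * pB.
have p0 : 0 < p by rewrite mulr_gt0.
have p1 : p <= 1 by rewrite /p; nra.
(* The expectation will be at most [1 + s ^+ 2 - p * s / 4], and [s <= p / 8] reduces this to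
   [1 - p * s / 8]. *)
exists (p / 8); first by apply/andP; split; lra.
move=> i j s ij /andP[s0 sp].
have s1 : 0 <= s <= 1 by apply/andP; split; lra.
pose E := X i @^-1` A `&` X j @^-1` B.
have PE : P E = p%:E.
  rewrite (sigma_cylinder_indep Xindep (K1 := [set i]) (K2 := [set j])).
  - by rewrite pAE pBE.
  - by apply/seteqP; split=> // k [-> /= e]; rewrite e eqxx in ij.
  - exact: adapted_preimage (adapted_coord X i) mA.
  - exact: adapted_preimage (adapted_coord X j) mB.
have mE : measurable E.
  by apply: measurableI; rewrite -[X in measurable X]setTI; exact: mX.
pose m w := Num.min (expR (- (s * X i w))) (expR (- (s * X j w))).
have mexp k : measurable_fun setT (fun w => expR (- (s * X k w))).
  apply: measurableT_comp => //; apply: measurableT_comp => //.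
  exact: measurable_funM.
have mm : measurable_fun setT (EFin \o m).
  by apply/measurable_EFinP; exact: measurable_minr.
have m0 w : 0 <= m w by rewrite le_min !expR_ge0.
have half k : (\int[P]_w ((2^-1)%:E * (expR (- (s * X k w)))%:E) =
    (2^-1 * expR (s ^+ 2 / 2))%:E)%E.
  rewrite ge0_integralZl//; last exact/measurable_EFinP.
  have := mgf_standard_normal Xnormal k (- s).
  rewrite sqrrN EFinM => <-.
  by congr (_ * _)%E; apply: eq_integral => w _; rewrite mulNr.
(* The minimum is at most the average. On [E] one exponential is at least 1 and the other at most
   [1 - s / 2], so half their gap is at least [s / 4]. *)
have : (\int[P]_w ((m w)%:E + (s / 4)%:E * (\1_E w)%:E) <=
    \int[P]_w ((2^-1)%:E * (expR (- (s * X i w)))%:E +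
               (2^-1)%:E * (expR (- (s * X j w)))%:E))%E.
  apply: ge0_le_integral => //.
  - move=> w _; rewrite adde_ge0 ?mule_ge0 ?lee_fin//; lra.
  - apply: emeasurable_funD => //; apply: measurable_funeM.
    exact/measurable_EFinP/measurable_indic.
  - by apply: emeasurable_funD; apply: measurable_funeM; exact/measurable_EFinP.
  - move=> w _; rewrite -!EFinM -!EFinD lee_fin /m indicE.
    have [Ew|nEw] := pselect (E w); last first.
      by rewrite memNset//= mulr0 addr0;
        case: (lerP (expR (- (s * X i w))) (expR (- (s * X j w)))) => ?; lra.
    rewrite mem_set//= mulr1.
    move: Ew; rewrite /E/A/B/= !in_itv/= => -[/andP[_ Xi0] /andP[Xj1 _]].
    have ei : 1 <= expR (- (s * X i w)).
      by rewrite -[leLHS]expR0 ler_expR; nra.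
    have ej : expR (- (s * X j w)) <= 1 - s / 2.
      by apply: le_trans (expRN_le s1); rewrite ler_expR; nra.
    by case: (lerP (expR (- (s * X i w))) (expR (- (s * X j w)))) => ?; lra.
rewrite !ge0_integralD//; last 5 first.
  - by apply: measurable_funeM; exact/measurable_EFinP.
  - by apply: measurable_funeM; exact/measurable_EFinP.
  - by move=> w _; rewrite lee_fin.
  - by move=> w _; rewrite mule_ge0// lee_fin; lra.
  - by apply: measurable_funeM; exact/measurable_EFinP/measurable_indic.
rewrite !half ge0_integralZl//; last 2 first.
  - exact/measurable_EFinP/measurable_indic.
  - by rewrite lee_fin; lra.
rewrite integral_indic// setIT [X in (_ + _ * X)%E]PE -EFinM -EFinD.
rewrite -leeBrDr// -EFinB => /le_trans; apply; rewrite lee_fin.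
apply: le_trans (expR_ge1Dx _).
have := expR_half_sqr_le s1; nra.
Qed.

End min_of_two.

(** * The greedy branch *)

Section greedy.
Context {d : measure_display} {Omega : measurableType d} {R : realType}.
Variables (P : probability Omega R) (xi : btree -> {RV P >-> R}).
Hypothesis xi_normal : forall v, standard_normal (xi v).
Hypothesis xi_indep : mutually_independent xi.

(** The exponential of minus the weighted sum of [xi] over [n] steps below [t], each to the child
    with the larger value; ties go to [false]. *)
Fixpoint greedy (c : nat -> R) (n : nat) (t : btree) (w : Omega) : R :=
  if n isn't n'.+1 then 1 else
  let u := rcons t false in let v := rcons t true in
  if xi v w <= xi u w
  then expR (- (c (size t).+1 * xi u w)) * greedy c n' u w
  else expR (- (c (size t).+1 * xi v w)) * greedy c n' v w.

Lemma greedy_attained (c : nat -> R) (n : nat) (t : btree) (w : Omega) :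
  exists2 s : seq bool, size s = n & greedy c n t w =
    expR (- \sum_(0 <= j < n) c (size t + j.+1)%N * xi (t ++ take j.+1 s) w).
Proof.
elim: n t => [|n IH] t /=.
  by exists [::] => //; rewrite big_geq// oppr0 expR0.
have step b : exists2 s : seq bool, size s = n.+1 &
    expR (- (c (size t).+1 * xi (rcons t b) w)) * greedy c n (rcons t b) w =
    expR (- \sum_(0 <= j < n.+1) c (size t + j.+1)%N * xi (t ++ take j.+1 s) w).
  have [s sn ->] := IH (rcons t b).
  exists (b :: s); first by rewrite /= sn.
  rewrite -expRD -opprD big_nat_recl//= addn1 take0 cats1; congr (expR (- (_ + _))).
  by apply: eq_bigr => j _; rewrite size_rcons addSnnS cat_rcons.
by case: ifP => _; exact: step.
Qed.

Lemma greedy_ge0 (c : nat -> R) (n : nat) (t : btree) (w : Omega) :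
  0 <= greedy c n t w.
Proof. by have [s _ ->] := greedy_attained c n t w; exact: expR_ge0. Qed.

(** The factor of one step, set to 0 when [b] is not the chosen child. It turns the random choice
    into a sum over both children, whose terms are products of independent factors. *)
Definition greedy_step (c : R) (t : btree) (b : bool) (w : Omega) : R :=
  if (xi (rcons t true) w <= xi (rcons t false) w) == ~~ b
  then expR (- (c * xi (rcons t b) w)) else 0.

Lemma greedyS (c : nat -> R) (n : nat) (t : btree) (w : Omega) :
  greedy c n.+1 t w =
    greedy_step (c (size t).+1) t false w * greedy c n (rcons t false) w +
    greedy_step (c (size t).+1) t true w * greedy c n (rcons t true) w.
Proof.
by rewrite /greedy_step /=; case: ifP => _ /=; rewrite mul0r ?addr0 ?add0r.
Qed.

Lemma greedy_step_ge0 (c : R) (t : btree) (b : bool) (w : Omega) :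
  0 <= greedy_step c t b w.
Proof. by rewrite /greedy_step; case: ifP => // _; exact: expR_ge0. Qed.

Lemma greedy_step_sum (c : R) (t : btree) (w : Omega) : 0 <= c ->
  greedy_step c t false w + greedy_step c t true w =
  Num.min (expR (- (c * xi (rcons t false) w))) (expR (- (c * xi (rcons t true) w))).
Proof.
move=> c0; rewrite /greedy_step; have [le|lt] := leP _ (xi (rcons t false) w).
  by rewrite /= addr0 min_l// ler_expR lerN2 ler_wpM2l.
by rewrite /= add0r min_r// ler_expR lerN2 ler_wpM2l// ltW.
Qed.

Definition children (t : btree) : set btree := [set rcons t b | b in setT].

Lemma adapted_greedy_step (c : R) (t : btree) (b : bool) :
  adapted xi (children t) (greedy_step c t b).
Proof.
have Kxi a : adapted xi (children t) (xi (rcons t a)).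
  by apply: (adaptedS _ (adapted_coord xi (rcons t a))) => _ ->; exists a.
have mexp a : adapted xi (children t) (fun w => expR (- (c * xi (rcons t a) w))).
  apply: measurableT_comp => //; apply: measurableT_comp => //.
  by apply: measurable_funM; [exact: measurable_cst|exact: Kxi].
have mle := measurable_fun_ler (Kxi true) (Kxi false).
case: b; rewrite /adapted.
  rewrite (_ : greedy_step c t true = fun w =>
    if xi (rcons t true) w <= xi (rcons t false) w then 0
    else expR (- (c * xi (rcons t true) w))); last first.
    by apply/funext => w; rewrite /greedy_step eqbF_neg; case: ifP; case: ifP.
  by apply: measurable_fun_ifT => //; exact: mexp.
rewrite (_ : greedy_step c t false = fun w =>
  if xi (rcons t true) w <= xi (rcons t false) w
  then expR (- (c * xi (rcons t false) w)) else 0); last first.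
  by apply/funext => w; rewrite /greedy_step eqb_id.
by apply: measurable_fun_ifT => //; exact: mexp.
Qed.

Definition below (t : btree) : set btree := [set s | tlt t s].

Lemma children_below (t : btree) : children t `<=` below t.
Proof.
move=> _ [b _ <-]; rewrite /below/= /tlt /tle prefix_rcons/=.
by apply/eqP => /(congr1 size); rewrite size_rcons => /n_Sn.
Qed.

Lemma below_rcons (t : btree) (b : bool) : below (rcons t b) `<=` below t.
Proof.
move=> s /andP[ts ne]; rewrite /below/= /tlt.
have ts' : tle t s by apply: prefix_trans ts; exact: prefix_rcons.
rewrite ts' /=; apply: contraTneq ts => <-; apply/negP => /size_prefix.
by rewrite size_rcons ltnn.
Qed.

Lemma children_below_rcons (t : btree) (b : bool) :
  children t `&` below (rcons t b) = set0.
Proof.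
apply/seteqP; split=> // _ [[a _ <-]] /andP[].
by rewrite /tle prefixE take_oversize ?size_rcons// => /eqP ->; rewrite eqxx.
Qed.

Lemma adapted_greedy (c : nat -> R) (n : nat) (t : btree) :
  adapted xi (below t) (greedy c n t).
Proof.
elim: n t => [|n IH] t; first exact: measurable_cst.
have -> : greedy c n.+1 t = fun w =>
    greedy_step (c (size t).+1) t false w * greedy c n (rcons t false) w +
    greedy_step (c (size t).+1) t true w * greedy c n (rcons t true) w.
  by apply/funext => w; exact: greedyS.
have K b : adapted xi (below t) (fun w =>
    greedy_step (c (size t).+1) t b w * greedy c n (rcons t b) w).
  apply: measurable_funM.
    exact: (adaptedS (@children_below t) (@adapted_greedy_step _ t b)).
  exact: (adaptedS (@below_rcons t b) (IH _)).
exact: measurable_funD (K false) (K true).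
Qed.

Lemma expectation_greedy (kappa : R) (c : nat -> R) :
  (forall i j (s : R), i != j -> 0 <= s <= kappa ->
    (\int[P]_w (Num.min (expR (- (s * xi i w))) (expR (- (s * xi j w))))%:E <=
     (expR (- (kappa * s)))%:E)%E) ->
  (forall n t, (forall k, (size t < k <= size t + n)%N -> 0 <= c k <= kappa) ->
  (\int[P]_w (greedy c n t w)%:E <=
   (expR (- (kappa * \sum_(0 <= j < n) c (size t + j.+1)%N)))%:E)%E).
Proof.
move=> Hmin; elim=> [|n IH] t ck.
  rewrite big_geq// mulr0 oppr0 expR0 /= integral_cst//=.
  by rewrite [X in (_ * X)%E]probability_setT mule1.
have /andP[c0 ck1] : 0 <= c (size t).+1 <= kappa.
  by apply: ck; rewrite leqnn/= addnS ltnS leq_addr.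
(* The induction hypothesis gives the same bound [M] below either child, so [M] factors out and the
   two steps add up to the minimum bounded by [Hmin]. *)
pose M := expR (- (kappa * \sum_(0 <= j < n) c ((size t).+1 + j.+1)%N)).
have IHM b : (\int[P]_w (greedy c n (rcons t b) w)%:E <= M%:E)%E.
  have := IH (rcons t b); rewrite size_rcons; apply => k /andP[tk kn].
  by apply: ck; rewrite (ltnW tk)/= -addSnnS.
under eq_integral do rewrite greedyS EFinD.
have mstep b : measurable_fun setT (EFin \o greedy_step (c (size t).+1) t b).
  by apply/measurable_EFinP; exact: adapted_measurable (@adapted_greedy_step _ t b).
have mgreedy b : measurable_fun setT (greedy c n (rcons t b)).
  exact: adapted_measurable (@adapted_greedy c n _).
have mprod b : measurable_fun setT (fun w =>
    (greedy_step (c (size t).+1) t b w * greedy c n (rcons t b) w)%:E).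
  by apply/measurable_EFinP/measurable_funM => //; exact/measurable_EFinP.
rewrite ge0_integralD//; last 2 first.
  by move=> w _; rewrite lee_fin mulr_ge0 ?greedy_step_ge0 ?greedy_ge0.
  by move=> w _; rewrite lee_fin mulr_ge0 ?greedy_step_ge0 ?greedy_ge0.
have split b : (\int[P]_w
    (greedy_step (c (size t).+1) t b w * greedy c n (rcons t b) w)%:E <=
    (\int[P]_w (greedy_step (c (size t).+1) t b w)%:E) * M%:E)%E.
  rewrite (expectation_mul_adapted xi_indep (children_below_rcons t b)
    (@adapted_greedy_step _ t b) (@adapted_greedy c n _)
    (greedy_step_ge0 _ t b) (greedy_ge0 c n _)).
  apply: lee_wpmul2l => //.
  by apply: integral_ge0 => w _; rewrite lee_fin greedy_step_ge0.
apply: le_trans (leeD (split false) (split true)) _.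
have int0 b : (0 <= \int[P]_w (greedy_step (c (size t).+1) t b w)%:E)%E.
  by apply: integral_ge0 => w _; rewrite lee_fin greedy_step_ge0.
rewrite -ge0_muleDl// -ge0_integralD//; last 4 first.
- by move=> w _; rewrite lee_fin greedy_step_ge0.
- exact: mstep.
- by move=> w _; rewrite lee_fin greedy_step_ge0.
- exact: mstep.
under eq_integral do rewrite -EFinD greedy_step_sum//.
rewrite big_nat_recl// mulrDr opprD expRD EFinM addn1.
under eq_bigr do rewrite -addSnnS.
apply: lee_pmul => //.
- by apply: integral_ge0 => w _; rewrite lee_fin le_min !expR_ge0.
- by rewrite lee_fin expR_ge0.
- apply: Hmin; last by rewrite c0.
  by apply/eqP => /(congr1 (last true)); rewrite !last_rcons.
Qed.

End greedy.

(** * Bounded families and lower bounds *)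

Lemma measurable_superlevel {d} {T : measurableType d} {R : realType}
    (f : T -> R) (y : R) :
  measurable_fun setT f -> measurable [set x | y < f x].
Proof.
move=> mf; have := mf measurableT `]y, +oo[%classic (measurable_itv _).
rewrite setTI; congr measurable.
by apply/seteqP; split=> x /=; rewrite in_itv/= andbT.
Qed.

Lemma ereal_sup_EFin_ltyP (R : realType) (T : Type) (D : set T) (u : T -> R) :
  (ereal_sup [set (u x)%:E | x in D] < +oo)%E <->
  exists C, forall x, D x -> u x <= C.
Proof.
split=> [|[C uC]].
  (* If [D] is empty, [M] is [-oo] and [fine M] is a default value, but then there is nothing to
     bound. *)
  set M := ereal_sup _ => My; exists (fine M) => x Dx.
  have : ((u x)%:E <= M)%E by apply: ereal_sup_ubound; exists x.
  by move: My; case: M => //= r _; rewrite lee_fin.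
apply: (@le_lt_trans _ _ C%:E); last exact: ltry.
by apply: ge_ereal_sup => _ [x Dx <-]; rewrite lee_fin; exact: uC.
Qed.

Section bounded_families.
Context {d : measure_display} {Omega : measurableType d} {R : realType}.
Variables (P : probability Omega R) (X : btree -> Omega -> R).
Hypothesis mX : forall t, measurable_fun setT (X t).

Definition bounded_by (B : R) : set Omega := [set w | forall t, `|X t w| <= B].

(** The tree is countable, so the complement is a countable union of superlevel sets. *)
Lemma measurable_bounded_by (B : R) : measurable (bounded_by B).
Proof.
rewrite (_ : bounded_by B = ~` \bigcup_t [set w | B < `|X t w|]); last first.
  rewrite setC_bigcup; apply/seteqP; split=> w /=.
    by move=> Xw t _ /=; apply/negP; rewrite -leNgt.
  by move=> Xw t; rewrite leNgt; apply/negP; exact: Xw.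
apply/measurableC/countable_bigcupT_measurable => [|t]; first exact: countableP.
apply: (@measurable_superlevel _ _ _ (fun w => `|X t w|)).
exact: measurableT_comp.
Qed.

Lemma bounded_setE :
  [set w | (ereal_sup [set `|X t w|%:E | t in [set: btree]] < +oo)%E] =
  \bigcup_k bounded_by k%:R.
Proof.
apply/seteqP; split=> w /=.
  move/ereal_sup_EFin_ltyP => [C XC].
  exists (Num.truncn C).+1 => // t; apply: le_trans (XC t I) _.
  by apply/ltW; exact: truncnS_gt.
by move=> [k _ Xk]; apply/ereal_sup_EFin_ltyP; exists k%:R => t _; exact: Xk.
Qed.

(** Continuity from below along the events [bounded_by k%:R]. The necessity proofs choose [q] so
    that this probability contradicts their upper bounds. *)
Lemma as_bounded_bounded_by (q : R) : as_bounded P X -> q < 1 ->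
  exists2 B : R, 0 <= B & (q%:E < P (bounded_by B))%E.
Proof.
rewrite /as_bounded bounded_setE => PB q1.
have : P (bounded_by k%:R) @[k --> \oo] --> P (\bigcup_k bounded_by k%:R).
  apply: nondecreasing_cvg_mu => [k||i j ij].
  - exact: measurable_bounded_by.
  - by apply: bigcup_measurable => k _; exact: measurable_bounded_by.
  - apply/subsetPset => w Xw t; apply: le_trans (Xw t) _.
    by rewrite ler_nat.
rewrite PB => cvgP.
have [k _ /(_ k (leqnn k)) /= Pk] : \forall k \near \oo, (q%:E < P (bounded_by k%:R))%E.
  by apply: (cvgP [set x | (q%:E < x)%E]); apply: open_ereal_gt'; rewrite lte_fin.
by exists k%:R.
Qed.

Lemma as_bounded_of_null (N : set Omega) : measurable N -> P N = 0%E ->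
  (forall w, ~ N w -> exists C, forall t, `|X t w| <= C) -> as_bounded P X.
Proof.
move=> mN PN Xbd; apply/eqP; rewrite eq_le probability_le1 ?bounded_setE/=; last first.
  by apply: bigcup_measurable => k _; exact: measurable_bounded_by.
have <- : P (~` N) = 1%E by rewrite probability_setC// PN sube0.
rewrite -bounded_setE; apply: le_measure; rewrite ?inE.
- exact: measurableC.
- rewrite bounded_setE.
  by apply: bigcup_measurable => k _; exact: measurable_bounded_by.
- by move=> w /Xbd[C XC]; apply/ereal_sup_EFin_ltyP; exists C => t _.
Qed.

End bounded_families.

Lemma ge0_markov_event {d} {Omega : measurableType d} {R : realType}
    (P : probability Omega R) (f : Omega -> R) (E : set Omega) (c : R) :
  measurable_fun setT f -> (forall w, 0 <= f w) -> measurable E -> 0 <= c ->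
  (forall w, E w -> c <= f w) -> (c%:E * P E <= \int[P]_w (f w)%:E)%E.
Proof.
move=> mf f0 mE c0 cf.
have <- : (\int[P]_w (c%:E * (\1_E w)%:E) = c%:E * P E)%E.
  rewrite ge0_integralZl//; last exact/measurable_EFinP/measurable_indic.
  by rewrite integral_indic// setIT.
apply: ge0_le_integral => //.
- by move=> w _; rewrite mule_ge0// lee_fin.
- by apply: measurable_funeM; exact/measurable_EFinP/measurable_indic.
- exact/measurable_EFinP.
- move=> w _; rewrite -EFinM lee_fin indicE.
  have [Ew|nEw] := pselect (E w); first by rewrite mem_set// mulr1 cf.
  by rewrite memNset// mulr0.
Qed.

Section tree_process_sums.
Context {d : measure_display} {Omega : measurableType d} {R : realType}.
Variables (P : probability Omega R) (xi : btree -> {RV P >-> R}).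
Variables (alpha sigma : nat -> R).

Definition path_sum (c : nat -> R) (t : btree) (w : Omega) : R :=
  \sum_(0 <= k < (size t).+1) c k * xi (take k t) w.

Local Notation X :=
  (tree_process (fun t => sigma (level t)) (fun t => alpha (level t)) xi).

Lemma tree_process_path_sum (t : btree) (w : Omega) :
  X t w = sigma (size t) * path_sum alpha t w.
Proof.
rewrite /tree_process levelE sum_ancestorsE; congr (_ * _).
rewrite /path_sum !big_nat; apply: eq_bigr => k /andP[_ kt].
by rewrite levelE size_takel.
Qed.

Lemma measurable_path_sum (c : nat -> R) (t : btree) :
  measurable_fun setT (path_sum c t).
Proof.
apply: measurable_sum => k; apply: measurable_funM; first exact: measurable_cst.
exact: measurable_funPT.
Qed.

Lemma measurable_tree_process (t : btree) : measurable_fun setT (X t).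
Proof.
rewrite (_ : X t = fun w => sigma (size t) * path_sum alpha t w).
  by apply: measurable_funM; [exact: measurable_cst|exact: measurable_path_sum].
by apply/funext => w; exact: tree_process_path_sum.
Qed.

Lemma path_sum_cat (c : nat -> R) (t s : btree) (w : Omega) :
  path_sum c (t ++ s) w = path_sum c t w +
    \sum_(0 <= j < size s) c (size t + j.+1)%N * xi (t ++ take j.+1 s) w.
Proof.
rewrite /path_sum size_cat -addSn.
rewrite (big_cat_nat (leq0n (size t).+1) (leq_addr (size s) (size t).+1))/=.
congr (_ + _).
  by rewrite !big_nat; apply: eq_bigr => k /andP[_ kt]; rewrite takel_cat.
rewrite -[X in \sum_(X <= _ < _) _]add0n big_addn addKn.
apply: eq_bigr => j _; rewrite addnS -addSn addnC take_cat.
by rewrite ltnNge leq_addr addKn.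
Qed.

Hypothesis sigma_gt0 : forall k, 0 < sigma k.
Hypothesis sigma_dec : nonincreasing_seq sigma.

Lemma bounded_by_increment (B : R) (t s : btree) (w : Omega) : 0 <= B ->
  bounded_by X B w ->
  \sum_(0 <= j < size s) alpha (size t + j.+1)%N * xi (t ++ take j.+1 s) w <=
  2 * B / sigma (size (t ++ s)).
Proof.
move=> B0 Bw; have := Bw (t ++ s); have := Bw t.
rewrite !tree_process_path_sum path_sum_cat.
set S := path_sum alpha t w; set U := \sum_(_ <= _ < _) _.
have := sigma_gt0 (size t); have := sigma_gt0 (size (t ++ s)).
have : sigma (size (t ++ s)) <= sigma (size t).
  by apply: sigma_dec; rewrite size_cat leq_addr.
move: (sigma _) (sigma (size t)) => x y xy x0 y0.
rewrite !ler_norml => /andP[h1 h2] /andP[h3 h4].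
rewrite ler_pdivlMr//.
(* The bound at [t] passes to the smaller factor [x]: it only helps when [S] is negative, and the
   other sign is trivial. *)
have : - B <= x * S.
  have [S0|S0] := lerP 0 S; first by apply: le_trans (mulr_ge0 (ltW x0) S0); lra.
  by apply: le_trans h1 _; nra.
nra.
Qed.

Hypothesis xi_normal : forall v, standard_normal (xi v).
Hypothesis xi_indep : mutually_independent xi.
Hypothesis alpha_gt0 : forall k, 0 < alpha k.

Lemma as_bounded_sum_le : as_bounded P X ->
  exists C, forall n, (1 <= n)%N -> sigma n * \sum_(1 <= k < n.+1) alpha k <= C.
Proof.
move=> bX.
have [kappa /andP[k0 k1] Hmin] := expectation_min_expR xi_normal xi_indep.
have q1 : expR (- (kappa ^+ 2 / 2)) < 1.
  by rewrite -[ltRHS]expR0 ltr_expR oppr_lt0 divr_gt0// exprn_gt0.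
have [B B0 PB] := as_bounded_bounded_by measurable_tree_process bX q1.
exists (4 * B / kappa) => n n1.
rewrite big_add1 /=.
set A := \sum_(0 <= j < n) alpha j.+1.
have A0 : 0 < A.
  rewrite /A; case: n n1 {A} => // n _; rewrite big_nat_recl//.
  by apply: ltr_wpDr => //; apply: sumr_ge0 => j _; exact/ltW.
pose lam := kappa / A; pose c k := lam * alpha k.
have lam0 : 0 < lam by rewrite divr_gt0.
have cA j : (j < n)%N -> alpha j.+1 <= A.
  move=> jn; rewrite /A (bigD1_seq j) ?mem_index_iota ?iota_uniq//=.
  by rewrite lerDl; apply: sumr_ge0 => i _; exact/ltW.
have ck k : (size ([::] : btree) < k <= size ([::] : btree) + n)%N -> 0 <= c k <= kappa.
  rewrite /= add0n; case: k => // k /= kn; rewrite /c mulr_ge0 ?(ltW lam0) ?(ltW (alpha_gt0 _))//=.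
  by rewrite /lam mulrAC ler_pdivrMr// ler_pM2l// cA.
have ED := expectation_greedy xi_indep Hmin ck.
have sumc : \sum_(0 <= j < n) c (size ([::] : btree) + j.+1)%N = kappa.
  by rewrite -mulr_sumr /= -/A /lam divfK// gt_eqF.
rewrite sumc -expr2 in ED.
(* The greedy branch depends on [w], but the increment bound holds along every branch. *)
have lowD w : bounded_by X B w ->
    expR (- (lam * (2 * B / sigma n))) <= greedy xi c n [::] w.
  move=> Bw; have [s sn ->] := greedy_attained xi c n [::] w.
  rewrite ler_expR lerN2 /c.
  under eq_bigr do rewrite -mulrA.
  rewrite -mulr_sumr ler_pM2l//.
  have := bounded_by_increment [::] s B0 Bw; rewrite !cat0s sn.
  exact.
have mB : measurable (bounded_by X B).
  by apply: measurable_bounded_by; exact: measurable_tree_process.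
have := ge0_markov_event P (adapted_measurable (@adapted_greedy _ _ _ P xi c n [::]))
  (greedy_ge0 xi c n [::]) mB (expR_ge0 _) lowD.
move=> /le_trans /(_ ED).
have Pfin : P (bounded_by X B) \is a fin_num by exact: fin_num_measure.
move: PB; rewrite -(fineK Pfin) lte_fin -EFinM lee_fin => PB PE.
have : expR (- (lam * (2 * B / sigma n)) - kappa ^+ 2 / 2) < expR (- kappa ^+ 2).
  rewrite expRD; apply: lt_le_trans PE.
  by rewrite ltr_pM2l// expR_gt0.
rewrite ltr_expR => H.
have {}H : kappa ^+ 2 / 2 < lam * (2 * B / sigma n) by lra.
have s0 := sigma_gt0 n.
have {}H : kappa / 2 < (2 * B) / (A * sigma n).
  rewrite -(ltr_pM2l k0); move: H; rewrite /lam.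
  rewrite (_ : kappa / A * _ = kappa * (2 * B / (A * sigma n))).
    by rewrite (_ : kappa ^+ 2 / 2 = kappa * (kappa / 2))//; ring.
  by field; rewrite !gt_eqF.
rewrite ltr_pdivlMr ?mulr_gt0// in H.
rewrite ler_pdivlMr// mulrC ltW//; nra.
Qed.

End tree_process_sums.

(** * The second moment method and independent branches *)

Section paley_zygmund.
Context {d : measure_display} {Omega : measurableType d} {R : realType}.

(** Integrates the pointwise bound of [Z] by [a / 2 + e / 2 * Z ^+ 2], plus [(e * 2)^-1] on [E]; on
    [E] it is the arithmetic-geometric mean inequality. *)
Lemma paley_zygmund (P : probability Omega R) (Z : Omega -> R) (a b : R) :
  measurable_fun setT Z -> (forall w, 0 <= Z w) -> 0 < a -> 0 < b ->
  (\int[P]_w (Z w)%:E = a%:E)%E -> (\int[P]_w (Z w ^+ 2)%:E = b%:E)%E ->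
  ((a ^+ 2 / (4 * b))%:E <= P [set w | (a / 2 < Z w)%R])%E.
Proof.
move=> mZ Z0 a0 b0 EZ EZ2.
pose E := [set w | a / 2 < Z w].
have mE : measurable E by exact: measurable_superlevel.
(* Chosen so that the quadratic term integrates to [a / 4], leaving [a / 4] for the event. *)
pose e := a / (2 * b).
have e0 : 0 < e by rewrite divr_gt0// mulr_gt0.
have mZ2 : measurable_fun setT (EFin \o (fun w => Z w ^+ 2)).
  by apply/measurable_EFinP; exact: measurable_funX.
have : (\int[P]_w (Z w)%:E <= \int[P]_w
    ((a / 2)%:E + ((e / 2)%:E * (Z w ^+ 2)%:E + ((e * 2)^-1)%:E * (\1_E w)%:E)))%E.
  apply: ge0_le_integral => //.
  - by move=> w _; rewrite lee_fin.
  - exact/measurable_EFinP.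
  - apply: emeasurable_funD; first exact: measurable_cst.
    apply: emeasurable_funD; apply: measurable_funeM => //.
    exact/measurable_EFinP/measurable_indic.
  - move=> w _; rewrite -!EFinM -!EFinD lee_fin indicE.
    have e2 : 0 <= e / 2 * Z w ^+ 2 by rewrite mulr_ge0 ?sqr_ge0// ltW// divr_gt0.
    have [Ew|nEw] := pselect (E w).
      rewrite mem_set//= mulr1.
      suff : Z w <= e / 2 * Z w ^+ 2 + (e * 2)^-1 by move=> ?; lra.
      rewrite -subr_ge0 (_ : _ - _ = (e * Z w - 1) ^+ 2 / (e * 2)).
        by rewrite divr_ge0 ?sqr_ge0// ltW// mulr_gt0.
      by field; rewrite gt_eqF.
    rewrite memNset//= mulr0 addr0.
    by move/negP: nEw; rewrite /E/= -leNgt => ?; lra.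
rewrite ge0_integralD//; last 3 first.
- by move=> w _; rewrite lee_fin ltW// divr_gt0.
- move=> w _; rewrite -!EFinM -EFinD lee_fin addr_ge0// mulr_ge0 ?sqr_ge0// ltW//.
    by rewrite divr_gt0.
  by rewrite invr_gt0 mulr_gt0.
- apply: emeasurable_funD; apply: measurable_funeM => //.
  exact/measurable_EFinP/measurable_indic.
rewrite ge0_integralD//; last 4 first.
- by move=> w _; rewrite -EFinM lee_fin mulr_ge0 ?sqr_ge0// ltW// divr_gt0.
- exact: measurable_funeM.
- by move=> w _; rewrite -EFinM lee_fin mulr_ge0// ltW// invr_gt0 mulr_gt0.
- by apply: measurable_funeM; exact/measurable_EFinP/measurable_indic.
rewrite !ge0_integralZl//; last 4 first.
- exact/measurable_EFinP/measurable_indic.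
- by rewrite lee_fin ltW// invr_gt0 mulr_gt0.
- by move=> w _; rewrite lee_fin sqr_ge0.
- by rewrite lee_fin ltW// divr_gt0.
rewrite integral_cst// [X in (_ * X + _)%E]probability_setT mule1 EZ EZ2.
rewrite integral_indic// setIT -/E.
have Efin : P E \is a fin_num by exact: fin_num_measure.
rewrite [Y in ((_^-1)%:E * Y)%E](esym (fineK Efin)) -!EFinM -!EFinD lee_fin.
move=> H; rewrite -(fineK Efin) lee_fin; move: H; set p := fine _ => H.
have {}H : a / 4 <= (e * 2)^-1 * p.
  have : e / 2 * b = a / 4 by rewrite /e; field; rewrite gt_eqF.
  lra.
rewrite (_ : (e * 2)^-1 * p = p * b / a) in H; last first.
  by rewrite /e; field; rewrite !gt_eqF.
rewrite ler_pdivlMr// in H; rewrite ler_pdivrMr ?mulr_gt0//.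
by rewrite expr2; lra.
Qed.

End paley_zygmund.

Section normal_path_tail.
Context {d : measure_display} {Omega : measurableType d} {R : realType}.
Variables (P : probability Omega R) (I : choiceType) (X : I -> {RV P >-> R}).
Hypothesis Xnormal : forall i, standard_normal (X i).
Hypothesis Xindep : mutually_independent X.

(* Paley-Zygmund for [expR (lam * U)], at [lam = sqrt h / (2 sqrt V)]. *)
Lemma linear_tail_ge (T : eqType) (r : seq T) (v : T -> I) (c : T -> R) (h : nat) :
  uniq r -> {in r &, injective v} -> 0 < \sum_(k <- r) c k ^+ 2 -> (16 <= h)%N ->
  ((2 ^- h)%R%:E <= P [set w |
     (Num.sqrt h%:R * Num.sqrt (\sum_(k <- r) c k ^+ 2) / 8 <
      \sum_(k <- r) c k * X (v k) w)%R])%E.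
Proof.
move=> ur vinj; set V := \sum_(k <- r) _ => V0 h16.
pose U w := \sum_(k <- r) c k * X (v k) w.
have mU : measurable_fun setT U.
  exact: adapted_measurable (adapted_linear X r v c).
have h0 : 0 < h%:R :> R by rewrite ltr0n (leq_trans _ h16).
have sh0 : 0 < Num.sqrt h%:R :> R by rewrite sqrtr_gt0.
have sV0 : 0 < Num.sqrt V by rewrite sqrtr_gt0.
have sh2 : Num.sqrt h%:R ^+ 2 = h%:R :> R by rewrite sqr_sqrtr// ltW.
have sV2 : Num.sqrt V ^+ 2 = V by rewrite sqr_sqrtr// ltW.
(* Then [lam ^+ 2 * V = h / 4], so [Z] and its square have means [expR (h / 8)] and
   [expR (h / 2)]. *)
pose lam := Num.sqrt h%:R / (2 * Num.sqrt V).
have lam0 : 0 < lam by rewrite divr_gt0// mulr_gt0.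
have lamV : lam ^+ 2 * V = h%:R / 4.
  by rewrite /lam expr_div_n exprMn sh2 sV2; field; rewrite gt_eqF.
have mgf (m : R) : (\int[P]_w (expR (m * U w))%:E = (expR (m ^+ 2 * V / 2))%:E)%E.
  have := mgf_linear Xnormal Xindep (fun k => m * c k) ur vinj.
  under eq_bigr do rewrite exprMn.
  rewrite -mulr_sumr -/V => <-; apply: eq_integral => w _.
  by rewrite /U mulr_sumr; under eq_bigr do rewrite mulrA.
pose Z w := expR (lam * U w).
have mZ : measurable_fun setT Z.
  by apply: measurableT_comp => //; apply: measurable_funM; first exact: measurable_cst.
have EZ2 : (\int[P]_w (Z w ^+ 2)%:E = (expR (h%:R / 2))%:E)%E.
  rewrite (_ : h%:R / 2 = (2 * lam) ^+ 2 * V / 2); last first.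
    by rewrite exprMn -mulrA -mulrA (mulrA (lam ^+ 2)) lamV; field.
  rewrite -mgf; apply: eq_integral => w _; congr EFin.
  by rewrite /Z -expRM_natl mulrA.
have EZ : (\int[P]_w (Z w)%:E = (expR (h%:R / 8))%:E)%E.
  by rewrite /Z mgf lamV; congr (expR _)%:E; field.
have Z0 w : 0 <= Z w by exact: expR_ge0.
have := paley_zygmund mZ Z0 (expR_gt0 _) (expR_gt0 _) EZ EZ2.
rewrite (_ : expR _ ^+ 2 / (4 * _) = expR (- (h%:R / 4)) / 4); last first.
  rewrite -expRM_natl invfM (mulrCA _ 4^-1) -expRN -expRD mulrC; congr (expR _ / _).
  by field.
move=> PZ.
(* Since [expR (- (1 / 4))] is at least 3/4, the surplus [(3 / 2) ^+ h] over [2 ^- h] absorbs the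
   factor 1/4. *)
have pow : 2 ^- h <= expR (- (h%:R / 4)) / 4 :> R.
  have e34 : 3 / 4 <= expR (- (1 / 4)) :> R by apply: le_trans (expR_ge1Dx _); lra.
  have -> : expR (- (h%:R / 4)) = expR (- (1 / 4)) ^+ h :> R.
    by rewrite -expRM_natl; congr expR; field.
  have : (3 / 4) ^+ h <= expR (- (1 / 4)) ^+ h :> R.
    by apply: lerXn2r; rewrite ?nnegrE ?expR_ge0//; lra.
  have : 4 <= (3 / 2) ^+ h :> R.
    apply: (@le_trans _ _ ((3 / 2) ^+ 4)); first lra.
    by apply: ler_weXn2l; [lra|exact: leq_trans h16].
  rewrite (_ : (3 / 4) ^+ h = (3 / 2) ^+ h * 2 ^- h :> R); last first.
    by rewrite -exprVn -exprMn; congr (_ ^+ _); field.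
  have : 0 < 2 ^- h :> R by rewrite invr_gt0 exprn_gt0.
  nra.
apply: (@le_trans _ _ (expR (- (h%:R / 4)) / 4)%:E); first by rewrite lee_fin.
apply: le_trans PZ _; apply: le_measure; rewrite ?inE.
- exact: measurable_superlevel.
- exact: measurable_superlevel.
move=> w /= Zw; rewrite -(ltr_pM2l lam0) -ltr_expR; apply: le_lt_trans Zw.
rewrite (_ : lam * _ = h%:R / 16); last first.
  by rewrite /lam -[in RHS]sh2; field; rewrite gt_eqF.
have -> : expR (h%:R / 8) = expR (h%:R / 16) * expR (h%:R / 16) :> R.
  by rewrite -expRD; congr expR; field.
(* This absorbs the halving of the mean in the Paley-Zygmund threshold. *)
have : 2 <= expR (h%:R / 16) :> R.
  apply: le_trans (expR_ge1Dx _).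
  have : 16 <= h%:R :> R by rewrite (ler_nat _ 16).
  lra.
nra.
Qed.

End normal_path_tail.

Section branching_lower_bound.
Context {d : measure_display} {Omega : measurableType d} {R : realType}.
Variables (P : probability Omega R) (xi : btree -> {RV P >-> R}).
Variables (alpha sigma : nat -> R).
Hypothesis xi_normal : forall v, standard_normal (xi v).
Hypothesis xi_indep : mutually_independent xi.
Hypothesis alpha_gt0 : forall k, 0 < alpha k.
Hypothesis sigma_gt0 : forall k, 0 < sigma k.
Hypothesis sigma_dec : nonincreasing_seq sigma.

Local Notation X :=
  (tree_process (fun t => sigma (level t)) (fun t => alpha (level t)) xi).

Lemma onem_expn_le (h : nat) : (1 - 2 ^- h) ^+ (2 ^ h) <= expR (- 1) :> R.
Proof.
have p0 : 0 < 2 ^- h :> R by rewrite invr_gt0 exprn_gt0.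
have p1 : 2 ^- h <= 1 :> R by rewrite invf_le1 ?exprn_gt0// exprn_ege1// ler1n.
apply: (@le_trans _ _ (expR (- 2 ^- h) ^+ (2 ^ h))).
  by apply: lerXn2r; rewrite ?nnegrE ?expR_ge0 ?subr_ge0//; exact: expR_ge1Dx.
by rewrite -expRM_natl mulrN natrX mulfV.
Qed.

(* The vertices [t] at level [h] are followed by disjoint branches, along which
   the increments of the process are independent. *)
Lemma bounded_by_le_expRN1 (B : R) (h m : nat) :
  0 <= B -> (16 <= h)%N -> (0 < m)%N ->
  2 * B / sigma (h + m) <= Num.sqrt h%:R *
    Num.sqrt (\sum_(0 <= j < m) alpha (h + j.+1)%N ^+ 2) / 8 ->
  (P (bounded_by X B) <= (expR (- 1))%:E)%E.
Proof.
move=> B0 h16 m0 By.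
set y := (X in _ <= X) in By.
(* Below [t] the branch always turns to [false]. Its vertices start at level [h + 1], and their
   first [h] letters recover [t], whence disjointness. *)
pose v (t : h.-tuple bool) (j : nat) : btree := t ++ nseq j.+1 false.
pose r := index_iota 0 m.
pose U t w := \sum_(j <- r) alpha (h + j.+1)%N * xi (v t j) w.
have vinj t : {in r &, injective (v t)}.
  move=> i j _ _ /(congr1 size); rewrite !size_cat !size_nseq => /addnI[].
  exact.
pose K t := [set v t j | j in [set` r]].
have KU t : adapted xi (K t) (U t) by exact: adapted_linear.
have mU t : measurable_fun setT (U t) by exact: adapted_measurable (KU t).
pose E t := [set w | U t w <= y].
pose f t w : R := \1_(E t) w.
have sE t : <<s cylinder xi (K t) >> (E t).
  have := adapted_preimage (KU t) (measurable_itv `]-oo, y]).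
  by congr (<<s _ >> _); apply/seteqP; split=> w /=; rewrite in_itv.
have mE t : measurable (E t) by exact: measurable_sigma_cylinder (sE t).
have Kf t : adapted xi (K t) (f t).
  have mEt : measurable (E t : set (g_sigma_algebraType (cylinder xi (K t)))).
    exact: sE.
  by have := measurable_indic (R := R) (D := setT) mEt.
have Kdisj (t u : h.-tuple bool) : t != u -> K t `&` K u = set0.
  move=> tu; apply/seteqP; split=> // _ [[i _ <-] [j _ /(congr1 (take h))]].
  rewrite /v !take_size_cat ?size_tuple// => /val_inj ut.
  by move: tu; rewrite ut eqxx.
have PE t : (\int[P]_w (f t w)%:E <= (1 - 2 ^- h)%:E)%E.
  rewrite integral_indic// setIT -[leLHS]/(P (E t)).
  rewrite (_ : E t = ~` [set w | y < U t w]); last first.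
    by apply/seteqP; split=> w; rewrite /E/= leNgt => /negP.
  rewrite probability_setC; last exact: measurable_superlevel.
  rewrite EFinB leeB// linear_tail_ge// ?iota_uniq//.
  case: m m0 {By y r U vinj K KU mU E f sE mE Kf Kdisj} => // m _.
  rewrite big_nat_recl// ltr_wpDr ?exprn_gt0//.
  by apply: sumr_ge0 => j _; exact: sqr_ge0.
have bE : bounded_by X B `<=` [set w | forall t, E t w].
  move=> w Bw t; have := bounded_by_increment sigma_gt0 sigma_dec t (nseq m false) B0 Bw.
  rewrite size_cat size_nseq size_tuple => /le_trans/(_ By).
  congr (_ <= _); rewrite /U !big_nat; apply: eq_bigr => j /andP[_ jm].
  by rewrite take_nseq//.
have mB : measurable (bounded_by X B).
  by apply: measurable_bounded_by; exact: measurable_tree_process.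
have mprodf : measurable_fun setT (fun w => \prod_(t <- index_enum (h.-tuple bool)) f t w).
  by apply: measurable_prod => t _; exact: adapted_measurable (Kf t).
have f0 t w : 0 <= f t w by rewrite /f indicE.
have := ge0_markov_event P mprodf _ mB ler01.
rewrite mul1e; move=> /(_ _ _)/le_trans; apply.
- by move=> w; apply: prodr_ge0.
- move=> w /bE Ew; rewrite big1// => t _.
  by rewrite /f indicE mem_set//; exact: Ew.
rewrite (expectation_prod_adapted xi_indep (K := K))//; last 2 first.
- exact: index_enum_uniq.
- by move=> t u _ _; exact: Kdisj.
have ffin t : (\int[P]_w (f t w)%:E)%E \is a fin_num.
  by rewrite integral_indic// setIT fin_num_measure.
under eq_bigr do rewrite -(fineK (ffin _)).
rewrite prodEFin lee_fin.
apply: le_trans (onem_expn_le h).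
apply: (@le_trans _ _ (\prod_(t : h.-tuple bool) (1 - 2 ^- h))).
  apply: ler_prod => t _; apply/andP; split.
    by rewrite fine_ge0// integral_ge0// => w _; rewrite lee_fin.
  by rewrite -lee_fin fineK.
by rewrite prodr_const card_tuple card_bool.
Qed.

Lemma as_bounded_sqrt_le : nondecreasing_seq alpha -> as_bounded P X ->
  exists C, forall n, (1 <= n)%N ->
    sigma n * Num.sqrt n%:R * Num.sqrt (\sum_(0 <= k < n.+1) alpha k ^+ 2) <= C.
Proof.
move=> alpha_inc bX.
pose u n := sigma n * Num.sqrt n%:R * Num.sqrt (\sum_(0 <= k < n.+1) alpha k ^+ 2).
have u0 n : 0 <= u n by rewrite !mulr_ge0// ltW.
(* Finitely many small [n] are absorbed into the constant; from 32 on, half of [n] is at least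
   16. *)
suff [C uC] : exists C, forall n, (32 <= n)%N -> u n <= C.
  exists (\sum_(0 <= n < 32) u n + `|C|) => n _; rewrite -/(u n).
  have [n32|n32] := ltnP n 32.
    rewrite (bigD1_seq n) ?mem_index_iota ?iota_uniq//= -addrA lerDl.
    by rewrite addr_ge0// sumr_ge0.
  apply: le_trans (uC n n32) _; apply: le_trans (ler_norm _) _.
  by rewrite lerDr sumr_ge0.
have q1 : expR (- 1) < 1 :> R by rewrite -[ltRHS]expR0 ltr_expR ltrN10.
have [B B0 PB] := as_bounded_bounded_by (measurable_tree_process xi alpha sigma) bX q1.
(* 48 is 2 * 8 * 3: [small] gives 2 * 8, and [n <= 3 * h] with [sumV] gives 3. *)
exists (48 * B) => n n32.
pose h := n./2; pose m := (n - h)%N.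
have nE : n = (h + m)%N by rewrite /m subnKC// /h -divn2 leq_div.
have h16 : (16 <= h)%N by rewrite /h; have := odd_double_half n; lia.
have hm : (h <= m)%N by rewrite /m /h; have := odd_double_half n; lia.
have m3 : (n <= 3 * h)%N by rewrite /h; have := odd_double_half n; lia.
pose V := \sum_(0 <= j < m) alpha (h + j.+1)%N ^+ 2.
have V0 : 0 <= V by apply: sumr_ge0 => j _; exact: sqr_ge0.
have small : Num.sqrt h%:R * Num.sqrt V / 8 < 2 * B / sigma n.
  rewrite ltNge; apply/negP; rewrite {1}nE => /(bounded_by_le_expRN1 B0 h16) H.
  by move: PB; rewrite ltNge => /negP; apply; apply: H; lia.
rewrite ltr_pdivrMr// in small.
(* By monotonicity the levels up to [h] contribute at most [h.+1] times [alpha h ^+ 2], while [V] is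
   at least [m] times it, and [h.+1 <= 2 * m]. *)
have sumV : \sum_(0 <= k < n.+1) alpha k ^+ 2 <= 3 * V.
  have -> : \sum_(0 <= k < n.+1) alpha k ^+ 2 =
      \sum_(0 <= k < h.+1) alpha k ^+ 2 + V.
    rewrite {1}nE -addSn (big_cat_nat (leq0n h.+1) (leq_addr m h.+1))/=.
    congr (_ + _); rewrite -[X in \sum_(X <= _ < _) _]add0n big_addn addKn.
    by apply: eq_bigr => j _; rewrite addnS -addSn addnC.
  have : \sum_(0 <= k < h.+1) alpha k ^+ 2 <= 2 * V.
    apply: (@le_trans _ _ ((h.+1)%:R * alpha h ^+ 2)).
      apply: (@le_trans _ _ (\sum_(0 <= k < h.+1) alpha h ^+ 2)).
        rewrite !big_nat; apply: ler_sum => k /andP[_ kh].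
        by apply: lerXn2r; rewrite ?nnegrE ?(ltW (alpha_gt0 _))//; exact: alpha_inc.
      by rewrite big_const_nat iter_addr addr0 subn0 mulr_natl.
    apply: (@le_trans _ _ (2 * (m%:R * alpha h ^+ 2))).
      rewrite mulrA ler_wpM2r ?sqr_ge0// -natrM ler_nat; lia.
    rewrite ler_pM2l//.
    apply: (@le_trans _ _ (\sum_(0 <= j < m) alpha h ^+ 2)).
      by rewrite big_const_nat iter_addr addr0 subn0 mulr_natl.
    apply: ler_sum => j _; apply: lerXn2r; rewrite ?nnegrE ?(ltW (alpha_gt0 _))//.
    by apply: alpha_inc; exact: leq_addr.
  lra.
rewrite /u -mulrA -sqrtrM ?ler0n//.
apply: (@le_trans _ _ (sigma n * (3 * (Num.sqrt h%:R * Num.sqrt V)))).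
  rewrite ler_pM2l// -sqrtrM ?ler0n//.
  rewrite -[3]ger0_norm// -sqrtr_sqr -sqrtrM ?sqr_ge0//.
  rewrite ler_wsqrtr//.
  rewrite (_ : 3 ^+ 2 * (h%:R * V) = (3 * h%:R) * (3 * V)); last by ring.
  apply: ler_pM => //.
  - by apply: sumr_ge0 => k _; exact: sqr_ge0.
  - by rewrite -natrM ler_nat.
have s0 := sigma_gt0 n; rewrite -(ler_pM2l (_ : 0 < (sigma n)^-1)) ?invr_gt0//.
rewrite mulKf ?gt_eqF//.
lra.
Qed.

End branching_lower_bound.

(** * Upper bounds *)

Section path_sum_upper_bound.
Context {d : measure_display} {Omega : measurableType d} {R : realType}.
Variables (P : probability Omega R) (xi : btree -> {RV P >-> R}).
Hypothesis xi_normal : forall v, standard_normal (xi v).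
Hypothesis xi_indep : mutually_independent xi.

Lemma mgf_path_sum (c : nat -> R) (t : btree) (s : R) :
  (\int[P]_w (expR (s * path_sum xi c t w))%:E =
   (expR (s ^+ 2 * (\sum_(0 <= k < (size t).+1) c k ^+ 2) / 2))%:E)%E.
Proof.
have tinj : {in index_iota 0 (size t).+1 &, injective (fun k => take k t : btree)}.
  move=> i j; rewrite !mem_index_iota !ltnS /= => it jt /(congr1 size).
  by rewrite !size_takel.
have := mgf_linear xi_normal xi_indep (fun k => s * c k) (iota_uniq _ _) tinj.
under eq_bigr do rewrite exprMn.
rewrite -mulr_sumr => <-; apply: eq_integral => w _.
by rewrite /path_sum mulr_sumr; under eq_bigr do rewrite mulrA.
Qed.

(* The sum over all vertices of [expR (- 3n) * expR (lam * `|S|)], where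
   [lam = sqrt (n / v)], has finite expectation: it is at most a geometric
   series of ratio [2 * expR (- 5/2)]. *)
Lemma path_sum_le_sqrt (c : nat -> nat -> R) :
  (forall n, (1 <= n)%N -> 0 < \sum_(0 <= k < n.+1) c n k ^+ 2) ->
  exists N, [/\ measurable N, P N = 0%E & forall w, ~ N w ->
    exists2 K : R, 0 <= K & forall t, (1 <= size t)%N ->
      `|path_sum xi (c (size t)) t w| <= K * (Num.sqrt (size t)%:R *
         Num.sqrt (\sum_(0 <= k < (size t).+1) c (size t) k ^+ 2))].
Proof.
move=> v0; pose v n := \sum_(0 <= k < n.+1) c n k ^+ 2.
pose lam n : R := Num.sqrt n%:R / Num.sqrt (v n).
have vge0 n : 0 <= v n by apply: sumr_ge0 => k _; exact: sqr_ge0.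
(* At [n = 0] both sides vanish because [lam 0] is 0, whatever [v 0] is. *)
have lamv n : lam n ^+ 2 * v n = n%:R.
  case: n => [|n]; first by rewrite /lam sqrtr0 mul0r expr0n mul0r.
  rewrite /lam expr_div_n !sqr_sqrtr ?ler0n// divfK// gt_eqF//; exact: v0.
pose S n (t : n.-tuple bool) w := path_sum xi (c n) t w.
(* The sum of the two exponentials dominates that of the absolute value and has an explicit
   expectation. *)
pose g n (t : n.-tuple bool) w :=
  expR (- (3 * n%:R)) * (expR (lam n * S n t w) + expR (- lam n * S n t w)).
have g0 n t w : 0 <= g n t w by rewrite mulr_ge0 ?addr_ge0 ?expR_ge0.
have mS n t : measurable_fun setT (S n t) by exact: measurable_path_sum.
have mexp n t (a : R) : measurable_fun setT (fun w => expR (a * S n t w)).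
  by apply: measurableT_comp => //; apply: measurable_funM; first exact: measurable_cst.
have mg n t : measurable_fun setT (EFin \o g n t).
  apply/measurable_EFinP; apply: measurable_funM; first exact: measurable_cst.
  by apply: measurable_funD; exact: mexp.
have Eg n t : (\int[P]_w (g n t w)%:E = (2 * expR (- (5 / 2 * n%:R)))%:E)%E.
  under eq_integral do rewrite EFinM EFinD.
  rewrite ge0_integralZl//; last 2 first.
  - by apply: emeasurable_funD; apply/measurable_EFinP; exact: mexp.
  - by move=> w _; rewrite lee_fin addr_ge0 ?expR_ge0.
  rewrite ge0_integralD//; [|exact/measurable_EFinP/mexp..].
  rewrite /S !mgf_path_sum size_tuple sqrrN -/(v n) lamv -EFinD -EFinM.
  rewrite (_ : - (5 / 2 * n%:R) = - (3 * n%:R) + n%:R / 2); last by field.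
  by rewrite expRD; congr EFin; ring.
pose G n w : \bar R := (\sum_(t <- index_enum (n.-tuple bool)) (g n t w)%:E)%E.
have G0 n w : (0 <= G n w)%E by apply: sume_ge0 => t _; rewrite lee_fin.
have mG n : measurable_fun setT (G n) by apply: emeasurable_sum => t; exact: mg.
(* There are [2 ^ n] vertices at level [n], and [2 * expR (- (5 / 2)) <= 1 / 2] follows from
   [expR (5 / 4) >= 9 / 4]. *)
have EG n : (\int[P]_w G n w <= (2 * 2^-1 ^+ n)%:E)%E.
  rewrite ge0_integral_sum//; last 2 first.
  - by move=> t; exact: mg.
  - by move=> t w _; rewrite lee_fin.
  under eq_bigr do rewrite Eg.
  rewrite sumEFin lee_fin sumr_const card_tuple card_bool -[leLHS]mulr_natl natrX.
  rewrite mulrCA ler_pM2l// (_ : - (5 / 2 * n%:R) = n%:R * - (5 / 2)); last by field.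
  rewrite expRM_natl -exprMn lerXn2r ?nnegrE ?mulr_ge0 ?expR_ge0//.
  rewrite expRN -ler_pdivlMr ?invr_gt0 ?expR_gt0// invrK.
  rewrite -(ler_pM2l (_ : 0 < 2 :> R))// mulrA divff// mul1r.
  have := expR_ge1Dx (5 / 4 : R).
  have -> : expR (5 / 2) = expR (5 / 4) * expR (5 / 4) :> R.
    by rewrite -expRD; congr expR; field.
  nra.
pose W w := (\sum_(n <oo) G n w)%E.
have EW : (\int[P]_w W w < +oo)%E.
  rewrite integral_nneseries//.
  apply: (@le_lt_trans _ _ 4%:E); last exact: ltry.
  apply: lime_le; first by apply: is_cvg_nneseries => i _ _; exact: integral_ge0.
  apply: nearW => m.
  apply: (@le_trans _ _ (\sum_(0 <= i < m) (2 * 2^-1 ^+ i)%:E)%E).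
    by apply: lee_sum => i _; exact: EG.
  rewrite sumEFin lee_fin.
  have -> : \sum_(0 <= i < m) 2 * 2^-1 ^+ i = 4 - 4 * 2^-1 ^+ m :> R.
    elim: m => [|m IH]; first by rewrite big_geq// expr0; lra.
    by rewrite big_nat_recr//= IH exprS; field.
  by rewrite lerBlDr lerDl mulr_ge0// exprn_ge0// invr_ge0.
have W0 w : (0 <= W w)%E by exact: nneseries_ge0.
have mW : measurable_fun setT W.
  rewrite (_ : W = fun w => (\sum_(n <oo | n \in predT) G n w)%E)//.
  exact: ge0_emeasurable_sum.
have iW : P.-integrable setT W.
  apply/integrableP; split => //.
  by under eq_integral do rewrite gee0_abs//.
have [N [mN PN NW]] := integrable_ae measurableT iW.
exists N; split => // w nNw.
have Wfin : W w \is a fin_num.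
  by apply: contrapT => nW; apply: nNw; apply: NW => /(_ I).
(* Each term is at most [W w], itself at most its exponential; taking logarithms, [lam n] times the
   path sum is at most [3 * n + W w], hence at most [(3 + W w) * n]. *)
exists (3 + fine (W w)); first by rewrite addr_ge0// fine_ge0.
move=> t; move nE : (size t) => n n1.
pose tt : n.-tuple bool := Tuple (introT eqP nE).
have gW : g n tt w <= fine (W w).
  rewrite -lee_fin fineK//.
  apply: (@le_trans _ _ (G n w)).
    rewrite /G (bigD1_seq tt) ?index_enum_uniq ?mem_index_enum//=.
    by rewrite leeDl// sume_ge0// => u _; rewrite lee_fin.
  apply: le_trans (nneseries_lim_ge n.+1 _); last by [].
  by rewrite big_nat_recr//= leeDr// sume_ge0.
set r := fine (W w) in gW *.
have sv0 : 0 < Num.sqrt (v n) by rewrite sqrtr_gt0; exact: v0.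
have sn0 : 0 < Num.sqrt n%:R :> R by rewrite sqrtr_gt0 ltr0n.
have lam0 : 0 < lam n by rewrite divr_gt0.
have lamS : lam n * `|S n tt w| <= 3 * n%:R + r.
  rewrite -ler_expR expRD.
  apply: (@le_trans _ _ (expR (3 * n%:R) * g n tt w)).
    rewrite /g mulrA -expRD subrr expR0 mul1r.
    have [S0|S0] := lerP 0 (S n tt w).
      by rewrite ger0_norm// lerDl expR_ge0.
    by rewrite ltr0_norm// mulrN -mulNr lerDr expR_ge0.
  rewrite ler_pM2l ?expR_gt0//; apply: le_trans gW _.
  by apply: le_trans (expR_ge1Dx r); rewrite lerDr.
rewrite -(ler_pM2l lam0); apply: le_trans lamS _.
rewrite -/(v n) (_ : lam n * _ = (3 + r) * Num.sqrt n%:R ^+ 2); last first.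
  by rewrite /lam; field; rewrite gt_eqF.
rewrite sqr_sqrtr//.
have r0 : 0 <= r by exact: fine_ge0.
have n1R : 1 <= n%:R :> R by rewrite ler1n.
nra.
Qed.

End path_sum_upper_bound.

(** * Sufficiency of the two conditions *)

Section sufficiency.
Context {d : measure_display} {Omega : measurableType d} {R : realType}.
Variables (P : probability Omega R) (xi : btree -> {RV P >-> R}).
Variables (alpha sigma : nat -> R).
Hypothesis xi_normal : forall v, standard_normal (xi v).
Hypothesis xi_indep : mutually_independent xi.
Hypothesis alpha_gt0 : forall k, 0 < alpha k.
Hypothesis sigma_gt0 : forall k, 0 < sigma k.
Hypothesis sigma_dec : nonincreasing_seq sigma.

Local Notation X :=
  (tree_process (fun t => sigma (level t)) (fun t => alpha (level t)) xi).

Lemma sqrt_bound_as_bounded (C : R) :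
  (forall n, (1 <= n)%N ->
    sigma n * Num.sqrt n%:R * Num.sqrt (\sum_(0 <= k < n.+1) alpha k ^+ 2) <= C) ->
  as_bounded P X.
Proof.
move=> HC.
have v0 n : (1 <= n)%N -> 0 < \sum_(0 <= k < n.+1) alpha k ^+ 2.
  move=> _; rewrite big_nat_recl// ltr_wpDr ?exprn_gt0//.
  by apply: sumr_ge0 => k _; exact: sqr_ge0.
have [N [mN PN bN]] := path_sum_le_sqrt xi_normal xi_indep (c := fun=> alpha) v0.
apply: (as_bounded_of_null (measurable_tree_process xi alpha sigma) mN PN) => w Nw.
have [K K0 HK] := bN w Nw.
(* The root needs its own term, since the bounds start at level 1. *)
exists (`|K * C| + `|X [::] w|) => t.
have [t0|t0] := posnP (size t); first by rewrite (size0nil t0) lerDr.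
rewrite tree_process_path_sum normrM gtr0_norm//.
apply: (@le_trans _ _ (K * C)); last first.
  by apply: le_trans (ler_norm _) _; rewrite lerDl.
apply: le_trans (ler_wpM2l K0 (HC _ t0)).
apply: le_trans (ler_wpM2l (ltW (sigma_gt0 _)) (HK t t0)) _.
by rewrite mulrCA (mulrA (sigma _)).
Qed.

Lemma sum_bound_as_bounded (C0 C : R) :
  (forall n k, (1 <= n)%N -> (n <= k <= 2 * n)%N -> alpha k <= C0 * alpha n) ->
  (forall n, (1 <= n)%N -> sigma n * \sum_(1 <= k < n.+1) alpha k <= C) ->
  as_bounded P X.
Proof.
move=> star; pose A n := \sum_(1 <= k < n.+1) alpha k.
rewrite -[forall n, _ -> _]/(forall n, (1 <= n)%N -> sigma n * A n <= C) => HC.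
have C01 : 1 <= C0.
  by have := star 1 1 isT isT; rewrite -{1}[alpha 1]mul1r ler_pM2r.
have A_add q h : (q <= h)%N -> A h = A q + \sum_(q.+1 <= k < h.+1) alpha k.
  by move=> qh; rewrite /A (@big_cat_nat _ _ _ q.+1).
have A0 n : 0 <= A n by apply: sumr_ge0 => k _; exact: ltW.
have A_le q h : (q <= h)%N -> A q <= A h.
  move=> qh; rewrite (A_add q h qh) lerDl.
  by apply: sumr_ge0 => k _; exact: ltW.
(* Every [k] kept satisfies [n./2.+1 <= k <= n <= 2 * n./2.+1], so doubling compares [alpha k] with
   [alpha n./2.+1]. *)
pose c n k := if (n./2 < k)%N then alpha k else 0.
have c_le n k : (k <= n)%N -> c n k ^+ 2 <= (C0 * alpha n./2.+1) ^+ 2.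
  move=> kn; rewrite /c; case: ifPn => hk; last by rewrite expr0n sqr_ge0.
  rewrite lerXn2r ?nnegrE ?mulr_ge0 ?(ltW (alpha_gt0 _))//; first lra.
  by apply: star => //; have := odd_double_half n; lia.
have v0 n : (1 <= n)%N -> 0 < \sum_(0 <= k < n.+1) c n k ^+ 2.
  move=> n1; rewrite big_nat_recr//= ltr_wpDl//.
    by apply: sumr_ge0 => k _; exact: sqr_ge0.
  rewrite /c ifT ?exprn_gt0//; have := odd_double_half n; lia.
have v_le n : \sum_(0 <= k < n.+1) c n k ^+ 2 <= n%:R * (C0 * alpha n./2.+1) ^+ 2.
  rewrite big_nat_recl//= /c ltn0 expr0n add0r -/(c n).
  apply: (@le_trans _ _ (\sum_(0 <= k < n) (C0 * alpha n./2.+1) ^+ 2)).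
    by rewrite !big_nat; apply: ler_sum => k /andP[_ kn]; exact: c_le.
  by rewrite big_const_nat iter_addr addr0 subn0 mulr_natl.
have [N [mN PN bN]] := path_sum_le_sqrt xi_normal xi_indep v0.
apply: (as_bounded_of_null (measurable_tree_process xi alpha sigma) mN PN) => w Nw.
have [K K0 HK] := bN w Nw.
pose S t := path_sum xi alpha t w.
(* One factor [C0] comes from [v_le], the other from comparing [alpha h.+1] with earlier terms; 6
   comes from [n <= 6 * (h - q)]. *)
pose K' := 6 * K * C0 ^+ 2.
have K'0 : 0 <= K' by rewrite mulr_ge0 ?sqr_ge0// mulr_ge0.
have Z_le t : (1 <= size t)%N -> `|S t - S (take (size t)./2 t)| <=
    K * C0 * ((size t)%:R * alpha (size t)./2.+1).
  move=> t1; set n := size t; set h := n./2.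
  have hn : (h <= n)%N by rewrite /h; have := odd_double_half n; lia.
  have -> : S t - S (take h t) = path_sum xi (c n) t w.
    rewrite /S -[in LHS](cat_take_drop h t) -[in RHS](cat_take_drop h t).
    rewrite !path_sum_cat take_size_cat ?size_takel// addrC addKr.
    rewrite [X in _ = X + _](_ : _ = 0) ?add0r.
      by apply: eq_bigr => j _; rewrite /c -/h addnS ltnS leq_addr.
    rewrite /path_sum size_takel// big_nat big1// => k /andP[_ kh].
    by rewrite /c -/h ltnNge -ltnS kh mul0r.
  apply: le_trans (HK t t1) _; rewrite -/n -mulrA ler_wpM2l//.
  have a0 := ltW (alpha_gt0 h.+1).
  apply: (@le_trans _ _ (Num.sqrt n%:R * Num.sqrt (n%:R * (C0 * alpha h.+1) ^+ 2))).
    by rewrite ler_wpM2l// ler_wsqrtr.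
  rewrite sqrtrM ?ler0n// sqrtr_sqr mulrA -expr2 sqr_sqrtr ?ler0n//.
  rewrite ger0_norm; last by rewrite mulr_ge0//; lra.
  by rewrite mulrCA.
(* The term [A n./2] makes the induction close: the increment costs [A h - A q], the hypothesis
   gives [A h + A q], and [2 * A h <= A n + A h]. *)
have claim n t : size t = n -> `|S t - S [::]| <= K' * (A n + A n./2).
  elim/ltn_ind: n t => n IH t tn.
  have [n0|n1] := posnP n.
    move: tn; rewrite n0 => /size0nil ->.
    by rewrite subrr normr0 mulr_ge0// addr_ge0.
  have := Z_le t; rewrite tn => /(_ n1) Zt.
  set h := n./2 in Zt *; set q := h./2.
  have hn : (h < n)%N by rewrite /h; have := odd_double_half n; lia.
  have qh : (q <= h)%N by rewrite /q; have := odd_double_half h; lia.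
  have sh : size (take h t) = h by rewrite size_takel// tn ltnW.
  have KC0 : 0 <= K * C0 by rewrite mulr_ge0//; lra.
  have [h0|h0] := posnP h.
    have n1E : n = 1%N by move: h0 n1; rewrite /h; have := odd_double_half n; lia.
    move: Zt; rewrite h0 take0 n1E mul1r => /le_trans; apply.
    have -> : A 1 = alpha 1 by rewrite /A big_nat1.
    apply: (@le_trans _ _ (K' * alpha 1)).
      rewrite ler_wpM2r// ?(ltW (alpha_gt0 _))// /K'.
      rewrite (_ : 6 * K * C0 ^+ 2 = K * C0 * (6 * C0)); last by ring.
      by rewrite ler_peMr//; lra.
    by rewrite ler_wpM2l// lerDl.
  have IHh := IH h hn _ sh.
  (* The increment between levels [h] and [n] is charged to the indices [k] in [(q, h]], for which
     [h.+1 <= 2 * k]. *)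
  have {}Zt : `|S t - S (take h t)| <= K' * (A h - A q).
    apply: le_trans Zt _; rewrite (A_add q h qh) addrC addKr.
    rewrite (_ : K' = K * C0 * (6 * C0)); last by rewrite /K'; ring.
    rewrite -[leRHS]mulrA ler_wpM2l//.
    apply: (@le_trans _ _ (6 * ((h - q)%:R * alpha h.+1))).
      rewrite mulrA ler_wpM2r ?(ltW (alpha_gt0 _))// -natrM ler_nat.
      have := odd_double_half n; have := odd_double_half n./2.
      by move: h0; rewrite /q /h; lia.
    rewrite -[leRHS]mulrA ler_pM2l// mulr_sumr.
    apply: (@le_trans _ _ (\sum_(q.+1 <= k < h.+1) alpha h.+1)).
      by rewrite big_const_nat iter_addr addr0 subSS mulr_natl.
    rewrite !big_nat; apply: ler_sum => k /andP[qk kh].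
    by apply: star; have := odd_double_half h; move: qk kh; rewrite /q; lia.
  have := A_le h n (ltnW hn).
  have : `|S t - S [::]| <= `|S t - S (take h t)| + `|S (take h t) - S [::]|.
    by apply: le_trans (ler_normD _ _); rewrite addrA subrK.
  move=> tri An; apply: le_trans tri _; apply: le_trans (lerD Zt IHh) _.
  rewrite -mulrDr ler_wpM2l// -/q; lra.
exists (sigma 0 * `|S [::]| + `|K' * 2 * C|) => t.
rewrite tree_process_path_sum normrM gtr0_norm// -/(S t).
have St : `|S t| <= `|S [::]| + K' * (2 * A (size t)).
  rewrite -[S t](subrK (S [::])) addrC; apply: le_trans (ler_normD _ _) _.
  rewrite lerD2l; apply: le_trans (claim _ _ (erefl (size t))) _.
  rewrite ler_wpM2l//.
  have : A (size t)./2 <= A (size t).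
    by apply: A_le; have := odd_double_half (size t); lia.
  lra.
apply: le_trans (ler_wpM2l (ltW (sigma_gt0 _)) St) _.
rewrite mulrDr lerD//.
  by rewrite ler_wpM2r//; apply: sigma_dec.
have [t0|t0] := posnP (size t).
  by rewrite t0 /A big_geq// !mulr0.
apply: le_trans (ler_norm _).
rewrite [leLHS](_ : _ = K' * 2 * (sigma (size t) * A (size t))); last by ring.
by rewrite ler_wpM2l ?HC// mulr_ge0.
Qed.

End sufficiency.

(** * The equivalences, with finite suprema read as uniform constants *)

Theorem theorem1p2 (d : measure_display) (Omega : measurableType d) (R : realType)
    (P : probability Omega R) (xi : btree -> {RV P >-> R})
    (alpha sigma : nat -> R) :
  (forall v, standard_normal (xi v)) ->
  mutually_independent xi ->
  (forall k, 0 < alpha k) ->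
  (forall k, 0 < sigma k) ->
  nonincreasing_seq sigma ->
  let X := tree_process (fun t => sigma (level t)) (fun t => alpha (level t)) xi in
  let cond_star :=
    (ereal_sup [set ereal_sup [set (alpha k / alpha n)%:E
                              | k in [set k | (n <= k <= 2 * n)%N]]
               | n in [set n | (1 <= n)%N]] < +oo)%E in
  let cond_starstar :=
    (ereal_sup [set (sigma n * \sum_(1 <= k < n.+1) alpha k)%:E
               | n in [set n | (1 <= n)%N]] < +oo)%E in
  [/\ cond_star -> (as_bounded P X <-> cond_starstar),
      nonincreasing_seq alpha ->
        cond_star /\ (as_bounded P X <-> cond_starstar)
    & nondecreasing_seq alpha ->
        (as_bounded P X <->
         (ereal_sup [set (sigma n * Num.sqrt n%:R *
                          Num.sqrt (\sum_(0 <= k < n.+1) alpha k ^+ 2))%:E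
                    | n in [set n | (1 <= n)%N]] < +oo)%E)].

Proof.
move=> xi_normal xi_indep alpha_gt0 sigma_gt0 sigma_dec X cond_star cond_starstar.
have starP : cond_star -> exists C0, forall n k, (1 <= n)%N ->
    (n <= k <= 2 * n)%N -> alpha k <= C0 * alpha n.
  (* The nested suprema are flattened into one over the admissible pairs. *)
  pose D := [set nk : nat * nat | (1 <= nk.1)%N /\ (nk.1 <= nk.2 <= 2 * nk.1)%N].
  move=> star.
  have [C HC] : exists C, forall nk, D nk -> alpha nk.2 / alpha nk.1 <= C.
    apply/ereal_sup_EFin_ltyP; apply: le_lt_trans star.
    apply: ge_ereal_sup => _ [[n k] [/= n1 nk] <-].
    apply: (@le_trans _ _ (ereal_sup [set (alpha k / alpha n)%:E
        | k in [set k | (n <= k <= 2 * n)%N]])).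
      by apply: ereal_sup_ubound; exists k.
    by apply: ereal_sup_ubound; exists n.
  exists C => n k n1 nk; rewrite -ler_pdivrMr//.
  exact: (HC (n, k)).
have part1 : cond_star -> as_bounded P X <-> cond_starstar.
  move=> /starP[C0 HC0]; split=> [bX|].
    apply/ereal_sup_EFin_ltyP.
    exact: (as_bounded_sum_le sigma_gt0 sigma_dec xi_normal xi_indep).
  move=> /ereal_sup_EFin_ltyP[C HC].
  exact: (sum_bound_as_bounded xi_normal xi_indep) HC0 HC.
split=> // [alpha_dec|alpha_inc].
  suff star : cond_star by split=> //; exact: part1.
  apply: (@le_lt_trans _ _ 1%:E); last exact: ltry.
  apply: ge_ereal_sup => _ [n _ <-]; apply: ge_ereal_sup => _ [k /= /andP[nk _] <-].
  by rewrite lee_fin ler_pdivrMr// mul1r; exact: alpha_dec.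
split=> [bX|].
  by apply/ereal_sup_EFin_ltyP; exact: (as_bounded_sqrt_le xi_normal xi_indep).
move=> /ereal_sup_EFin_ltyP[C HC].
exact: (sqrt_bound_as_bounded xi_normal xi_indep) HC.
Qed.
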